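(* There is a distillation protocol taking $64$ $T$ states to $2$ $\mathrm{TOF\#}$ states at distance $d=4$, obtained as follows. Consider the CSS code on $64$ qubits, with qubits indexed by $(x_1,\dots,x_6)\in\mathbb F_2^6$, whose $15$ $X$-logical rows are the evaluations of all degree-two monomials $x_ix_j$ ($1\le i<j\le 6$), and whose $X$-stabilizer rows are the evaluations of the monomials of degree less than two, i.e. of $x_1,\dots,x_6$ and of the constant function $1$. This code has $Z$-distance $4$ and $X$-distance $16$. The logical action of the physical transversal gate $T^{\otimes 64}$ on this code is a $CCZ$ circuit on the $15$ logical qubits (labelled by the monomials $x_ix_j$), with one $CCZ$ applied to every triple of $X$-logicals whose monomials multiply to the full monomial $x_1x_2x_3x_4x_5x_6$. Number the logical qubits $1,\dots,15$ in lexicographic order of the monomials, $x_1x_2,x_1x_3,\dots,x_1x_6,x_2x_3,\dots,x_5x_6$. If the logical qubits $3,4,7,8,12$ (associated to $x_1x_4,\ x_1x_5,\ x_2x_4,\ x_2x_5,\ x_3x_6$) are set to $|0\rangle$ before the physical $T$ gates are applied, then every $CCZ$ involving one of these qubits becomes trivial, and what is left is two decoupled $\mathrm{TOF\#}$ gates, one on the logical qubits $\{1,10,11,14,15\}$ (that is, $x_1x_2,\ x_3x_4,\ x_3x_5,\ x_4x_6,\ x_5x_6$) and one on the logical qubits $\{2,5,6,9,13\}$ (that is, $x_1x_3,\ x_1x_6,\ x_2x_3,\ x_2x_6,\ x_4x_5$). The error suppression of this protocol is $10256\,p^4$.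
   Context: $T=\mathrm{diag}(1,e^{i\pi/4})$, and $CCZ$ is the three-qubit gate $|z_1z_2z_3\rangle\mapsto(-1)^{z_1z_2z_3}|z_1z_2z_3\rangle$. The five-qubit gate $\mathrm{TOF\#}$ is $|z\rangle\mapsto(-1)^{z_1z_2z_3+z_3z_4z_5}|z\rangle$, i.e. two $CCZ$ gates sharing exactly one qubit; qubits may be relabelled. The magic state of a diagonal $n$-qubit gate $U$ is $U|+\rangle^{\otimes n}$. The evaluation of a polynomial $f$ in $x_1,\dots,x_6$ is the vector $(f(x))_{x\in\mathbb F_2^6}\in\mathbb F_2^{64}$. A full-rank binary matrix with $k$ designated logical rows (spanning, together with the remaining rows, a space $\mathcal G$) and remaining stabilizer rows (spanning $\mathcal G_0$) defines a CSS code with $k$ logical qubits: its $X$-stabilizers are given by $\mathcal G_0$, its $Z$-stabilizers by $\mathcal G^\perp$, and the logical rows are its $X$-logical operators. Its $Z$-distance is the minimum Hamming weight of an element of $\mathcal G_0^\perp\setminus\mathcal G^\perp$, and its $X$-distance is the minimum Hamming weight of an element of $\mathcal G\setminus\mathcal G_0$. The associated distillation protocol prepares a code state, applies noisy $T$ gates (each using one noisy input $T$ state, with $Z$ error probability $p$) to all physical qubits, measures the $X$-stabilizers, and outputs the decoded logical state if the syndrome is trivial. Its distance $d$ is the minimum number of input states that must be faulty to cause an undetected logical failure. The error suppression is the leading-order (in $p$) output error probability. *)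

(* Defs.v *)
From HB Require Import structures.
From mathcomp Require Import all_boot all_order all_algebra.
From mathcomp Require Import all_classical all_reals all_analysis.
From mathcomp Require Import complex.
From mathcomp.multinomials Require mpoly.
Import -(notations) mpoly.

Set Implicit Arguments.
Unset Strict Implicit.
Unset Printing Implicit Defensive.

Import Order.TTheory GRing.Theory Num.Theory.
Import numFieldNormedType.Exports.

Local Open Scope ring_scope.
Local Open Scope complex_scope.

Definition dot n (u v : 'rV['F_2]_n) : 'F_2 := \sum_(i < n) u 0 i * v 0 i.

Definition hamming n (v : 'rV['F_2]_n) : nat := #|[set i | v 0 i != 0]|.

Definition dual n (A : {set 'rV['F_2]_n}) : {set 'rV['F_2]_n} :=
  [set v | [forall u in A, dot u v == 0]].

(* [d] is the minimum of the Hamming weight on [A]; in particular [A] is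
   nonempty. *)
Definition min_weight n (A : {set 'rV['F_2]_n}) (d : nat) : Prop :=
  (exists2 v, v \in A & hamming v = d) /\ (forall v, v \in A -> d <= hamming v)%N.

Record css_matrix (k r n : nat) := CssMatrix {
  logical_rows : 'M['F_2]_(k, n);
  stab_rows : 'M['F_2]_(r, n) }.

Section CssMatrix.
Variables (k r n : nat) (c : css_matrix k r n).

Definition all_rows : 'M['F_2]_(k + r, n) :=
  col_mx (logical_rows c) (stab_rows c).

Definition full_rank : bool := row_free all_rows.

Definition spaceG0 : {set 'rV['F_2]_n} := [set v | (v <= stab_rows c)%MS].
Definition spaceG : {set 'rV['F_2]_n} := [set v | (v <= all_rows)%MS].

Definition Z_distance (d : nat) : Prop :=
  min_weight (dual spaceG0 :\: dual spaceG) d.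
Definition X_distance (d : nat) : Prop :=
  min_weight (spaceG :\: spaceG0) d.

End CssMatrix.

(* A pure state of [n] qubits is given by its amplitudes in the computational
   basis, which is indexed by F_2^n. *)
Notation state R n := {ffun 'rV['F_2]_n -> complex R}.

Section States.
Variable R : realType.

Definition inner n (phi psi : state R n) : R[i] :=
  \sum_z (phi z)^* * psi z.

Definition norm2 n (psi : state R n) : R :=
  \sum_z ComplexField.Normc.normc (psi z) ^+ 2.

Definition sign (b : 'F_2) : R[i] := (-1) ^+ (b : nat).

Definition pauliX n (v : 'rV['F_2]_n) (psi : state R n) : state R n :=
  [ffun z => psi (z - v)].

Definition pauliZ n (v : 'rV['F_2]_n) (psi : state R n) : state R n :=
  [ffun z => sign (dot v z) * psi z].

Definition diag_gate n (D : 'rV['F_2]_n -> R[i]) (psi : state R n) : state R n :=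
  [ffun z => D z * psi z].

Definition omega8 : R[i] := cos (pi / 4) +i* sin (pi / 4).

Definition T_diag (b : 'F_2) : R[i] := if b == 0 then 1 else omega8.

Definition transversal_T n : state R n -> state R n :=
  diag_gate (fun z : 'rV_n => \prod_(i < n) T_diag (z 0 i)).

(* CCZ on the set [t] of qubits, intended for [#|t| = 3] *)
Definition CCZ n (t : {set 'I_n}) : state R n -> state R n :=
  diag_gate (fun z : 'rV_n => sign (\prod_(l in t) z 0 l)).

Definition CCZ_circuit n (ts : {set {set 'I_n}}) (psi : state R n) : state R n :=
  foldr (@CCZ n) psi (enum ts).

Definition TOFs_diag (z : 'rV['F_2]_5) : R[i] :=
  let z_ i := z 0 (inord i.-1) in
  sign (z_ 1 * z_ 2 * z_ 3 + z_ 3 * z_ 4 * z_ 5).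

(* The bits carried by the qubits [f 0, f 1, ...] of a larger register *)
Definition wires m n (f : 'I_m -> 'I_n) (z : 'rV['F_2]_n) : 'rV['F_2]_m :=
  \row_i z 0 (f i).

Definition TOFs_on n (f : 'I_5 -> 'I_n) : state R n -> state R n :=
  diag_gate (fun z => TOFs_diag (wires f z)).

Definition plus_state n : state R n := [ffun=> ((Num.sqrt 2)^-1)%:C ^+ n].

Definition magic_state n (D : 'rV['F_2]_n -> R[i]) : state R n :=
  diag_gate D (plus_state n).

(* |0> on the qubits of [A], |+> on the others *)
Definition zero_plus_state n (A : {set 'I_n}) : state R n :=
  [ffun z : 'rV_n => \prod_(l < n) if l \in A then (z 0 l == 0)%:R
                           else ((Num.sqrt 2)^-1)%:C].

(* [psi] is |0> on the qubits of [A], tensored with any state of the others. *)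
Definition zero_on n (A : {set 'I_n}) (psi : state R n) : Prop :=
  forall z, psi z != 0 -> forall l, l \in A -> z 0 l = 0.

(* The product of [phi] on the qubits [f 0, f 1, ...], [psi] on the qubits
   [g 0, g 1, ...], and |0> on the qubits of [A]; meaningful when [f] and [g] are
   injective and their images, together with [A], partition the qubits. *)
Definition product_state m1 m2 n (f : 'I_m1 -> 'I_n) (g : 'I_m2 -> 'I_n)
    (A : {set 'I_n}) (phi : state R m1) (psi : state R m2) : state R n :=
  [ffun z : 'rV_n => phi (wires f z) * psi (wires g z) * \prod_(l in A) (z 0 l == 0)%:R].

End States.

Section Encoding.
Variables (R : realType) (k r n : nat) (c : css_matrix k r n).

(* The logical basis state |z>_L = |G_0|^{-1/2} \sum_(g in G_0) |g + z L>, with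
   [L] the matrix of the logical rows. *)
Definition logical_ket (z : 'rV['F_2]_k) : state R n :=
  [ffun y => (y - z *m logical_rows c \in spaceG0 c)%:R
             * ((Num.sqrt (#|spaceG0 c|%:R))^-1)%:C].

Definition encode (phi : state R k) : state R n :=
  [ffun y => \sum_z phi z * logical_ket z y].

(* The adjoint of [encode], which inverts it on the code space *)
Definition decode (psi : state R n) : state R k :=
  [ffun z => inner (logical_ket z) psi].

Definition implements (U : state R n -> state R n) (V : state R k -> state R k) :=
  forall phi, U (encode phi) = encode (V phi).

(* The code is the CSS code of the matrix: its states are fixed by X^g for g in
   G_0 and by Z^h for h in the dual of G, and the logical rows act as logical X. *)
Lemma encode_Xstab g phi : g \in spaceG0 c -> pauliX g (encode phi) = encode phi.
Proof.
rewrite inE => gG0; apply/ffunP => y; rewrite !ffunE; apply: eq_bigr => z _.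
rewrite !ffunE !inE addrAC; set u := y - _.
suff -> : (u - g <= stab_rows c)%MS = (u <= stab_rows c)%MS by [].
apply/idP/idP => h; last by rewrite addmx_sub // eqmx_opp.
by rewrite -[u](subrK g) addmx_sub.
Qed.

Lemma encode_Zstab h phi : h \in dual (spaceG c) -> pauliZ h (encode phi) = encode phi.
Proof.
rewrite inE => /forallP hG; apply/ffunP => y; rewrite !ffunE.
rewrite big_distrr /=; apply: eq_bigr => z _.
rewrite !ffunE !inE; case: (boolP (_ <= _)%MS) => [yG|_]; last by rewrite !(mul0r, mulr0).
suff /eqP -> : dot h y == 0 by rewrite /sign expr0 mul1r.
have := hG y; rewrite inE.
have -> : (y <= all_rows c)%MS.
  rewrite -[y](subrK (z *m logical_rows c)) addrC.
  rewrite (eqmxP (_ : all_rows c == logical_rows c + stab_rows c)%MS) ?addmx_sub_adds ?submxMl //.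
  by rewrite /all_rows; apply/eqmxP/eqmx_sym/addsmxE.
by rewrite /dot; under eq_bigr do rewrite mulrC.
Qed.

Lemma encode_Xlogical a phi :
  pauliX (a *m logical_rows c) (encode phi) = encode (pauliX a phi).
Proof.
apply/ffunP => y; rewrite !ffunE [RHS](reindex_inj (addIr a)) /=.
apply: eq_bigr => z _; rewrite !ffunE addrK mulmxDl.
by rewrite opprD addrA addrAC.
Qed.

End Encoding.

Section Protocol.
Variables (R : realType) (k r n : nat) (c : css_matrix k r n).

(* The projection on the trivial syndrome of the X-stabilizers *)
Definition trivial_syndrome (psi : state R n) : state R n :=
  [ffun y => (\sum_(g in spaceG0 c) pauliX g psi y) / #|spaceG0 c|%:R].

Variables (input target : state R k).

(* The unnormalized state after the syndrome measurement, if the syndrome is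
   trivial and the i-th input T state is faulty exactly when [e 0 i = 1] *)
Definition accepted_state (e : 'rV['F_2]_n) : state R n :=
  trivial_syndrome (pauliZ e (transversal_T (encode c input))).

Definition output_state (e : 'rV['F_2]_n) : state R k :=
  decode c (accepted_state e).

(* Given the faults [e]: the probability that the syndrome is trivial, and the
   probability that moreover the output passes a projection on [target] *)
Definition accept_prob (e : 'rV['F_2]_n) : R := norm2 (accepted_state e).
Definition success_prob (e : 'rV['F_2]_n) : R :=
  ComplexField.Normc.normc (inner target (output_state e)) ^+ 2.

Definition undetected_failures : {set 'rV['F_2]_n} :=
  [set e | success_prob e < accept_prob e].

Definition protocol_distance (d : nat) : Prop := min_weight undetected_failures d.

Definition fault_prob (p : R) (e : 'rV['F_2]_n) : R :=
  p ^+ hamming e * (1 - p) ^+ (n - hamming e).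

(* The infidelity with [target] of the output, conditioned on acceptance *)
Definition output_error (p : R) : R :=
  1 - (\sum_e fault_prob p e * success_prob e)
      / (\sum_e fault_prob p e * accept_prob e).

(* [output_error p] is [a * p ^+ d] to leading order *)
Definition error_suppression (a : R) (d : nat) : Prop :=
  ((fun p : R => output_error p / p ^+ d) @ 0^'+ --> a)%classic.

End Protocol.

Notation poly6 := (mpoly.mpoly 6 'F_2).

(* Variables are numbered from 1 to 6. *)
Definition var (i : nat) : poly6 := mpoly.mpolyX 'F_2 (mpoly.mnm1 (inord i.-1)).

Definition eval (f : poly6) (x : 'rV['F_2]_6) : 'F_2 := mpoly.meval (fun i => x 0 i) f.

(* The pairs (i, j) with 1 <= i < j <= 6, in lexicographic order *)
Definition lex_pairs : seq (nat * nat) :=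
  [seq ij <- [seq (i, j) | i <- iota 1 6, j <- iota 1 6] | (ij.1 < ij.2)%N].

Definition quad_monomial (l : 'I_15) : poly6 :=
  let ij := nth (0, 0)%N lex_pairs l in var ij.1 * var ij.2.

Definition low_monomial (s : 'I_7) : poly6 :=
  nth 1 [:: var 1; var 2; var 3; var 4; var 5; var 6; 1] s.

(* [pt] is the labelling of the qubits by the points of F_2^6. *)
Definition quad_code (pt : 'I_64 -> 'rV['F_2]_6) : css_matrix 15 7 64 :=
  CssMatrix (\matrix_(l, q) eval (quad_monomial l) (pt q))
            (\matrix_(s, q) eval (low_monomial s) (pt q)).

Definition full_triples : {set {set 'I_15}} :=
  [set t : {set 'I_15} | (#|t| == 3) &&
           (\prod_(l in t) quad_monomial l == \prod_(1 <= i < 7) var i)].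

(* Logical qubits are numbered from 1 to 15. *)
Definition lq (m : nat) : 'I_15 := inord m.-1.
Definition lqs (ms : seq nat) : {set 'I_15} := [set l in map lq ms].

(* Main.v *)
(** A point of [F_2^6] is identified with its support, a subset of ['I_6], and a
monomial with the set of its variables; it takes the value 1 at the points containing
that set, which number [2 ^ (6 - degree)]. Since the parity of [s] is
[s - 2 C(s,2) + 4 C(s,3)] modulo 8, the weight of a sum of monomials of degree at most
two is, modulo 8, four times the number of triples of monomials with product
[x_1 ... x_6]; as [omega8 ^+ 4 = -1], the transversal [T] is the announced [CCZ]
circuit. Moebius inversion on a two-dimensional face reads off a coefficient [x_i x_j]
from any of the 16 parallel faces, which gives the rank and the X-distance.

A fault [e] is accepted exactly when its points have even cardinality and sum to
zero, and it then acts as [Z ^ s] on the output, where [s] collects the sums over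
[e] of the [x_i x_j]; the output is orthogonal to the target unless [s] is supported
on the zeroed qubits. The lightest nonzero accepted faults are the affine planes,
and for the plane [a + <u, v>] the vector [s] is the wedge product of [u] and [v].
Hence 24 times the number of failing planes is 64 times the number of pairs [(u, v)]
whose wedge is not supported on the zeroed qubits, which is 3846. *)

Require Import Defs.
From mathcomp Require Import all_boot all_order all_algebra.
From mathcomp Require Import all_classical all_reals all_analysis.
From mathcomp Require Import complex.
From mathcomp.multinomials Require mpoly.
Import -(notations) mpoly.
From mathcomp Require Import zify ring.

Set Implicit Arguments.
Unset Strict Implicit.
Unset Printing Implicit Defensive.

Import Order.TTheory GRing.Theory Num.Theory.
Import numFieldNormedType.Exports.

Local Open Scope ring_scope.

(** * Weights modulo 8 *)

(** Expanding [(1 - 2) ^ s = 1 - 2 odd s] by the binomial theorem and halving gives the identity up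
    to multiples of 8. Terms are moved across the equality to avoid truncated subtraction. *)
Lemma odd_add_binomials s : (odd s + 2 * 'C(s, 2) = s + 4 * 'C(s, 3) %[mod 8])%N.
Proof.
elim: s => // s IH; rewrite !binS bin1 /=.
have [] : ((odd s : nat) = 0 /\ ~~ odd s)%N \/ ((odd s : nat) = 1 /\ odd s)%N by case: (odd s); [right|left].
  by case=> E /negbTE F; move: IH; rewrite F /=; lia.
by case=> E F; move: IH; rewrite F /=; lia.
Qed.

Lemma card_supersets (T : finType) (U : {set T}) :
  #|[set x : {set T} | U \subset x]| = (2 ^ #|~: U|)%N.
Proof.
rewrite -card_powerset -(card_imset _ (@finset.setC_inj T)); apply: eq_card => x.
rewrite powersetE; apply/imsetP/idP => [[y]|xU].
  by rewrite inE => Uy ->; rewrite finset.setCS.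
by exists (~: x); rewrite ?finset.setCK // inE -finset.setCS finset.setCK.
Qed.

(** Double counting: the binomial counts the [k]-subsets of the indices satisfied at [x], and
    exchanging the sums fixes the subset first. *)
Lemma sum_bin_card (X J : finType) (P : J -> pred X) (A : {set J}) k :
  (\sum_x 'C(#|[set j in A | P j x]|, k) =
   \sum_(T : {set J} | (T \subset A) && (#|T| == k))
     #|[set x | [forall j in T, P j x]]|)%N.
Proof.
transitivity (\sum_x \sum_(T : {set J} | (T \subset A) && (#|T| == k))
   [forall j in T, P j x])%N.
  apply: eq_bigr => x _; rewrite -cards_draws -sum1_card big_mkcond /=.
  rewrite [RHS]big_mkcond /=; apply: eq_bigr => T _; rewrite inE.
  have -> : (T \subset [set j in A | P j x]) = (T \subset A) && [forall j in T, P j x].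
    apply/fintype.subsetP/andP => [sT|[/fintype.subsetP sT /forall_inP PT] j jT].
      split; first by apply/fintype.subsetP => j /sT; rewrite inE => /andP[].
      by apply/forall_inP => j /sT; rewrite inE => /andP[].
    by rewrite inE sT // PT.
  by case: (T \subset A); case: (#|T| == k); case: [forall (j | j \in T), P j x].
rewrite exchange_big; apply: eq_bigr => T _.
rewrite -sum1_card [RHS]big_mkcond /=; apply: eq_bigr => x _; rewrite inE.
by case: [forall (j | j \in T), P j x].
Qed.

(* Summing [odd s = s - 2 C(s,2) + 4 C(s,3)] over the points, the first two terms
   vanish modulo 8 because few variables occur. *)
Lemma weight_mod8 (T J : finType) (mon : J -> {set T}) (A : {set J}) :
  #|T| = 6%N -> (forall j, #|mon j| <= 2)%N ->
  (#|[set x : {set T} | odd #|[set j in A | mon j \subset x]|]| =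
   4 * #|[set t : {set J} | [&& t \subset A, #|t| == 3 & \bigcup_(j in t) mon j == [set: T]%SET]]|
   %[mod 8])%N.
Proof.
move=> T6 mon2; pose s (x : {set T}) := #|[set j in A | mon j \subset x]|.
have w (t : {set J}) : #|[set x : {set T} | [forall j in t, mon j \subset x]]| =
    (2 ^ (6 - #|\bigcup_(j in t) mon j|))%N.
  rewrite -T6 -(cardsC (\bigcup_(j in t) mon j)) addKn -card_supersets; apply: eq_card => x; rewrite !inE.
  by apply/forall_inP/bigcupsP.
have cov (t : {set J}) : (#|\bigcup_(j in t) mon j| <= 2 * #|t|)%N.
  apply: leq_trans (_ : \sum_(j in t) #|mon j| <= _)%N.
    apply: (big_ind2 (fun (U : {set T}) m => #|U| <= m)%N) => [|U m V m' Um Vm'|//].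
      by rewrite cards0.
    by rewrite (leq_trans (leq_card_setU _ _)) ?leq_add.
  by rewrite mulnC -sum_nat_const; apply: leq_sum.
(* By [cov], [k] monomials involve at most [2k] of the six variables, so the count in [w] is a
   multiple of 16 for [k = 1] and of 4 for [k = 2]; for [k = 3] it is odd exactly when all six
   variables occur. *)
have S1 : (8 %| \sum_x s x)%N.
  under eq_bigr do rewrite -[s _]bin1.
  rewrite sum_bin_card; apply: dvdn_sum => t /andP[_ /eqP t1].
  by rewrite w (dvdn_exp2l 2 (_ : 3 <= _)%N) //; move: (cov t); rewrite t1; lia.
have S2 : (4 %| \sum_x 'C(s x, 2))%N.
  rewrite sum_bin_card; apply: dvdn_sum => t /andP[_ /eqP t1].
  by rewrite w (dvdn_exp2l 2 (_ : 2 <= _)%N) //; move: (cov t); rewrite t1; lia.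
have S3 : (\sum_x 'C(s x, 3) =
   #|[set t : {set J} | [&& t \subset A, #|t| == 3 & \bigcup_(j in t) mon j == [set: T]%SET]]|
   %[mod 2])%N.
  rewrite sum_bin_card -sum1_card.
  under eq_bigl do rewrite inE andbA.
  rewrite [in RHS]big_mkcondr /= !modn2; congr (nat_of_bool _).
  apply: (big_ind2 (fun a b => odd a = odd b)) => // [a b c d|t _].
    by rewrite !oddD => -> ->.
  rewrite w oddX eqEcard finset.subsetT cardsT T6 /=.
  by rewrite subn_eq0 orbF; case: leqP.
move/eqP: S1; move/eqP: S2.
have : (\sum_x (odd (s x) + 2 * 'C(s x, 2)) = \sum_x (s x + 4 * 'C(s x, 3)) %[mod 8])%N.
  apply: (big_ind2 (fun a b => a = b %[mod 8]))%N => // [a b c d|x _]; last exact: odd_add_binomials.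
  by move=> ab cd; rewrite -modnDm ab cd modnDm.
rewrite !big_split /= !big1_eq.
have -> : (\sum_x odd (s x) = #|[set x : {set T} | odd #|[set j in A | mon j \subset x]|]|)%N.
  rewrite -sum1_card [RHS]big_mkcond /=; apply: eq_bigr => x _; rewrite inE /s.
  by case: (odd _).
move: S3; move: (\sum_x 'C(s x, 3))%N (\sum_x 'C(s x, 2))%N (\sum_x s x)%N #|_| #|_|.
by move=> c3 c2 c1 n m; lia.
Qed.

(** * Monomials as sets of variables *)

Lemma F2_cases (a : 'F_2) : a = 0 \/ a = 1.
Proof. by case: a => [[|[|m]] lt_m] //; [left|right]; apply: val_inj. Qed.

Lemma F2_natr (a : 'F_2) : a = (a != 0)%:R.
Proof. by case: (F2_cases a) => ->. Qed.

Lemma F2_natr_odd m : m%:R = (odd m)%:R :> 'F_2.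
Proof.
elim: m => // m IH; rewrite mulrS IH /=.
by case: (odd m); apply: val_inj.
Qed.

Lemma F2_oddr_neq0 (b : bool) : ((b%:R : 'F_2) != 0) = b.
Proof. by case: b. Qed.

Lemma F2_addrr (a : 'F_2) : a + a = 0.
Proof. by case: (F2_cases a) => ->; apply: val_inj. Qed.

Lemma F2_prod_natr (I : finType) (A : {set I}) (F : I -> 'F_2) :
  \prod_(i in A) F i = [forall i in A, F i != 0]%:R.
Proof.
case: (boolP [forall i in A, F i != 0]) => [/forall_inP F0|].
  by apply: big1 => i iA; rewrite [F i]F2_natr F0.
by rewrite negb_forall_in => /exists_inP[i iA /negPn/eqP Fi]; rewrite (bigD1 i) //= Fi mul0r.
Qed.

Lemma F2_sum_natr (I : finType) (A : {set I}) (P : pred I) :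
  \sum_(i in A) (P i)%:R = (odd #|[set i in A | P i]|)%:R :> 'F_2.
Proof.
rewrite -natr_sum [LHS]F2_natr_odd -sum1_card; congr (odd _)%:R.
rewrite [RHS](eq_bigl (fun i => (i \in A) && P i)); last by move=> i; rewrite inE.
by rewrite [RHS]big_mkcondr; apply: eq_bigr => i _; case: (P i).
Qed.

Definition supp n (v : 'rV['F_2]_n) : {set 'I_n} := [set i | v 0 i != 0].
Definition indicator n (A : {set 'I_n}) : 'rV['F_2]_n := \row_i (i \in A)%:R.

Lemma suppK n : cancel (@supp n) (@indicator n).
Proof. by move=> v; apply/rowP => i; rewrite mxE inE -F2_natr. Qed.

Lemma indicatorK n : cancel (@indicator n) (@supp n).
Proof. by move=> A; apply/setP => i; rewrite inE mxE F2_oddr_neq0. Qed.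

Lemma supp_bij n : bijective (@supp n).
Proof. exact: Bijective (@suppK n) (@indicatorK n). Qed.

Lemma supp_coef n (v : 'rV['F_2]_n) i : v 0 i = (i \in supp v)%:R.
Proof. by rewrite inE -F2_natr. Qed.

Lemma card_supp n (v : 'rV['F_2]_n) : #|supp v| = hamming v.
Proof. by []. Qed.

Lemma dotE n (u v : 'rV['F_2]_n) : dot u v = (odd #|supp u :&: supp v|)%:R.
Proof.
transitivity (\sum_(i in supp u) (i \in supp v)%:R : 'F_2).
  rewrite [RHS]big_mkcond; apply: eq_bigr => i _ /=; rewrite !supp_coef.
  by case: (i \in supp u); rewrite ?mul1r ?mul0r.
by rewrite F2_sum_natr; congr (odd _)%:R; apply: eq_card => i; rewrite !inE.
Qed.

(** The pairing is linear, so orthogonality may be tested on the generating rows. *)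
Lemma mem_dual_rowspace m n (M : 'M['F_2]_(m, n)) (e : 'rV['F_2]_n) :
  (e \in dual [set v | (v <= M)%MS]) = [forall i, dot (row i M) e == 0].
Proof.
have dotmx u : dot u e = (u *m e^T) 0 0.
  by rewrite mxE; apply: eq_bigr => i _; rewrite !mxE.
rewrite inE; apply/forall_inP/forallP => [h i|h u].
  by apply: h; rewrite inE row_sub.
rewrite inE => /submxP[D ->]; rewrite dotmx -mulmxA.
suff -> : M *m e^T = 0 by rewrite mulmx0 mxE.
apply/matrixP => i j; rewrite ord1 [RHS]mxE.
by have := eqP (h i); rewrite dotmx -row_mul mxE.
Qed.

(** * Sets of variables of the rows of the code *)

Definition pair_of (l : 'I_15) : {set 'I_6} :=
  let ij := nth (0, 0)%N lex_pairs l in [set inord ij.1.-1; inord ij.2.-1].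

(** Index 6 is the constant monomial, which has no variable. *)
Definition low_support (s : 'I_7) : {set 'I_6} :=
  if (s < 6)%N then [set inord s] else finset.set0.

Definition row_support (j : 'I_(15 + 7)) : {set 'I_6} :=
  match fintype.split j with inl l => pair_of l | inr s => low_support s end.

Lemma lex_pairs_lt (l : 'I_15) :
  let ij := nth (0, 0)%N lex_pairs l in (0 < ij.1 < ij.2)%N && (ij.2 <= 6)%N.
Proof.
have h : all (fun ij : nat * nat => (0 < ij.1 < ij.2)%N && (ij.2 <= 6)%N) lex_pairs by [].
by move/all_nthP: h => /(_ (0, 0)%N l); apply; exact: ltn_ord.
Qed.

Lemma pair_of_neq (l : 'I_15) :
  let ij := nth (0, 0)%N lex_pairs l in inord ij.1.-1 != inord ij.2.-1 :> 'I_6.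
Proof.
have := lex_pairs_lt l; case: (nth _ _ _) => i j /= h.
by apply/negP => /eqP /(congr1 val) /=; rewrite !inordK; lia.
Qed.

Lemma card_pair_of l : #|pair_of l| = 2%N.
Proof. by rewrite cards2 (pair_of_neq l : (_ != _) = true). Qed.

Lemma card_low_support s : (#|low_support s| <= 1)%N.
Proof. by rewrite /low_support; case: ifP; rewrite ?cards1 ?finset.cards0. Qed.

Lemma row_support_lshift l : row_support (lshift 7 l) = pair_of l.
Proof. by rewrite /row_support (fintype.unsplitK (inl l)). Qed.

Lemma row_support_rshift s : row_support (rshift 15 s) = low_support s.
Proof. by rewrite /row_support (fintype.unsplitK (inr s)). Qed.

Lemma card_row_support j : (#|row_support j| <= 2)%N.
Proof.
by rewrite /row_support; case: fintype.split => a;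
  rewrite ?card_pair_of // (leq_trans (card_low_support _)).
Qed.

(** The listed pairs are increasing, so each is determined by its underlying set, and the list has
    no repetition. *)
Lemma pair_of_inj : injective pair_of.
Proof.
move=> l l' /setP e; apply/val_inj/eqP.
have u : uniq lex_pairs by [].
rewrite -(nth_uniq (0, 0)%N _ _ u) ?ltn_ord //.
move: (lex_pairs_lt l) (lex_pairs_lt l') e; rewrite /pair_of.
case: (nth _ _ l) => i j /=; case: (nth _ _ l') => i' j' /= h h' e.
have := e (inord i.-1); have := e (inord j.-1).
have := e (inord i'.-1); have := e (inord j'.-1).
have [] : [/\ i.-1 < 6, j.-1 < 6, i'.-1 < 6 & j'.-1 < 6]%N by clear e; split; lia.
move=> bi bj bi' bj'; rewrite !in_set2 -!(inj_eq val_inj) /= !inordK // {u e}.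
rewrite -pair_eqE /pair_eq /= !eqxx !orbT /=.
clear -h h' => /orP e1 /orP e2 /esym/orP e3 /esym/orP e4.
by case: e1; case: e2; case: e3; case: e4 => /eqP ? /eqP ? /eqP ? /eqP ?; lia.
Qed.

Lemma low_support_inj : injective low_support.
Proof.
move=> s s'; rewrite /low_support; case: ltnP => hs; case: ltnP => hs'.
- move/finset.set1_inj => /(congr1 val) /=; rewrite !inordK // => e.
  exact: val_inj.
- by move/setP/(_ (inord s)); rewrite !inE eqxx.
- by move/setP/(_ (inord s')); rewrite !inE eqxx.
- by move=> _; apply: val_inj => /=; move: (ltn_ord s) (ltn_ord s'); lia.
Qed.

Lemma row_support_inj : injective row_support.
Proof.
move=> j j'; rewrite -[j]fintype.splitK -[j']fintype.splitK.
case: (fintype.split j) => a; case: (fintype.split j') => b /=;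
  rewrite ?row_support_lshift ?row_support_rshift => e.
- by rewrite (pair_of_inj e).
- by have := card_low_support b; rewrite -e card_pair_of.
- by have := card_low_support a; rewrite e card_pair_of.
- by rewrite (low_support_inj e).
Qed.

Lemma eval_quad_monomial l x : Defs.eval (quad_monomial l) x = (pair_of l \subset supp x)%:R.
Proof.
rewrite /Defs.eval /quad_monomial /pair_of; case: (nth _ _ l) => i j /=.
rewrite rmorphM /= !mevalXU !supp_coef finset.subUset !finset.sub1set.
by do 2 case: (_ \in supp x); apply: val_inj.
Qed.

Lemma eval_low_monomial s x : Defs.eval (low_monomial s) x = (low_support s \subset supp x)%:R.
Proof.
rewrite /Defs.eval /low_monomial /low_support.
case: s => [[|[|[|[|[|[|[|m]]]]]]] h] //=; rewrite ?mevalXU ?supp_coef ?finset.sub1set //=.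
by rewrite rmorph1 finset.sub0set.
Qed.

Section Code.
Variable pt : 'I_64 -> 'rV['F_2]_6.
Let c := quad_code pt.

Lemma all_rowsE j q : all_rows c j q = (row_support j \subset supp (pt q))%:R.
Proof.
rewrite -[j]fintype.splitK; case: (fintype.split j) => a /=.
  by rewrite row_support_lshift col_mxEu mxE eval_quad_monomial.
by rewrite row_support_rshift col_mxEd mxE eval_low_monomial.
Qed.

Lemma codewordE (v : 'rV_(15 + 7)) q :
  (v *m all_rows c) 0 q =
  (odd #|[set j in supp v | row_support j \subset supp (pt q)]|)%:R.
Proof.
rewrite mxE -F2_sum_natr [RHS]big_mkcond; apply: eq_bigr => j _ /=.
rewrite all_rowsE supp_coef.
by case: (j \in supp v); rewrite ?mul1r ?mul0r.
Qed.

End Code.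

Lemma mpolyX_inj n (R : nzRingType) : injective (@mpolyX n R).
Proof.
move=> m k /(congr1 (mcoeff k)); rewrite !mcoeffX eqxx.
by case: eqP => // _ /esym/eqP; rewrite oner_eq0.
Qed.

(** Three pairs have six entries in total, so they cover the six variables exactly when every
    variable occurs once, that is, when the product has all exponents equal to 1. *)
Lemma full_triplesE t :
  (t \in full_triples) = (#|t| == 3%N) && (\bigcup_(l in t) pair_of l == [set: 'I_6]%SET).
Proof.
rewrite inE; case: eqP => //= t3.
pose m (l : 'I_15) := let ij := nth (0, 0)%N lex_pairs l in
  mnm_add (mnm1 (inord ij.1.-1)) (mnm1 (inord ij.2.-1)) : multinom 6.
have mE l i : m l i = (i \in pair_of l).
  have := pair_of_neq l; rewrite /m /pair_of; case: (nth _ _ l) => a b /= ab.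
  rewrite mnmDE !mnm1E in_set2 ![i == _]eq_sym.
  by case: (eqVneq (inord a.-1) i) ab => [<-|_]; rewrite // eq_sym => /negbTE ->.
have -> : \prod_(l in t) quad_monomial l = mpolyX 'F_2 (\big[mnm_add/mnm0]_(l in t) m l).
  by rewrite -mprodXE; apply: eq_bigr => l _; rewrite mpolyXD.
have -> : \prod_(1 <= i < 7) var i =
    mpolyX 'F_2 (\big[mnm_add/mnm0]_(1 <= i < 7) mnm1 (inord i.-1)).
  by rewrite -mprodXE.
rewrite (inj_eq (@mpolyX_inj _ _)).
have full (i : 'I_6) : (\big[mnm_add/mnm0]_(1 <= k < 7) mnm1 (inord k.-1) : multinom 6) i = 1%N.
  rewrite mnm_sumE (eq_bigr (fun k => (inord k.-1 == i) : nat)); last by move=> k _; rewrite mnm1E.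
  rewrite unlock /= -!(inj_eq val_inj) /= !inordK //.
  by case: i => [[|[|[|[|[|[|?]]]]]] h].
have total : (\sum_i \sum_(l in t) (i \in pair_of l) = 6)%N.
  rewrite exchange_big /= (eq_bigr (fun=> 2%N)) ?sum_nat_const ?t3 //.
  by move=> l _; rewrite -big_mkcond sum1_card card_pair_of.
apply/eqP/eqP => [e|/setP e].
  apply/setP => i; rewrite finset.in_setT; apply/bigcupP.
  have : (0 < \sum_(l in t) (i \in pair_of l))%N.
    by under eq_bigr do rewrite -mE; rewrite -mnm_sumE e full.
  rewrite lt0n sum_nat_eq0 negb_forall_in => /exists_inP[l lt].
  by rewrite eqb0 negbK; exists l.
have ge1 i : (1 <= \sum_(l in t) (i \in pair_of l))%N.
  have /bigcupP[l lt il] : i \in \bigcup_(l in t) pair_of l by rewrite e inE.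
  by rewrite (bigD1 l) //= il.
apply/mnmP => i; rewrite full mnm_sumE.
under eq_bigr do rewrite mE.
apply/eqP; rewrite eqn_leq ge1 andbT.
have : (\sum_(k < 6 | k != i) 1 <= \sum_(k < 6 | k != i) \sum_(l in t) (k \in pair_of l))%N.
  by apply: leq_sum => k _; exact: ge1.
rewrite sum1_card cardC1 card_ord.
by move: total; rewrite (bigD1 i) //=; move: (\sum_(l in t) _)%N (\sum_(k < 6 | _) _)%N; lia.
Qed.

(** * Parameters of the code *)

(** The interval between [A] and [U] is empty or has [2 ^ #|U :\: A|] elements. This parity is what
    makes Moebius inversion over [F_2] a plain sum over subsets. *)
Lemma odd_card_interval (T : finType) (A U : {set T}) :
  odd #|[set W in powerset U | A \subset W]| = (A == U).
Proof.
case: (boolP (A \subset U)) => AU; last first.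
  rewrite (_ : [set W in _ | _] = finset.set0) ?finset.cards0.
    by apply/esym/negbTE; apply: contraNneq AU => ->.
  apply/setP => W; rewrite !inE; apply/negbTE; apply: contraNN AU => /andP[WU AW].
  exact: fintype.subset_trans AW WU.
have -> : #|[set W in powerset U | A \subset W]| = #|powerset (U :\: A)|.
  have inj : {in powerset (U :\: A) &, injective (fun W => A :|: W)}.
    move=> W W'; rewrite !inE !finset.subsetD => /andP[_ dW] /andP[_ dW'] /setP e.
    apply/setP => i; have := e i; rewrite !inE; case: (boolP (i \in A)) => //= iA _.
    by rewrite (disjointFl dW iA) (disjointFl dW' iA).
  rewrite -(card_in_imset inj); apply: eq_card => W; rewrite inE powersetE.
  apply/andP/imsetP => [[WU AW]|[W']].
    exists (W :\: A); first by rewrite powersetE finset.setSD.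
    by apply/setP => i; rewrite !inE; case: (boolP (i \in A)) => // /(fintype.subsetP AW).
  rewrite powersetE finset.subsetD => /andP[W'U _] ->.
  by rewrite finset.subUset AU W'U finset.subsetUl.
rewrite card_powerset oddX /= orbF cards_eq0 finset.setD_eq0.
by rewrite finset.eqEsubset AU.
Qed.

Section Weights.
Variables (pt : 'I_64 -> 'rV['F_2]_6) (pt_bij : bijective pt).
Let c := quad_code pt.
Let sp q := supp (pt q).

Lemma point_bij : bijective sp.
Proof. exact: bij_comp (supp_bij 6) pt_bij. Qed.

Lemma card_points (P : pred {set 'I_6}) : #|[set q | P (sp q)]| = #|[set x | P x]|.
Proof.
rewrite -!sum1_card [RHS](reindex sp) /=; last exact/onW_bij/point_bij.
by apply: eq_bigl => q; rewrite !inE.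
Qed.

Definition codeword_at (v : 'rV['F_2]_(15 + 7)) (x : {set 'I_6}) :=
  odd #|[set j in supp v | row_support j \subset x]|.

Lemma hamming_codeword v :
  hamming (v *m all_rows c) = #|[set x | codeword_at v x]|.
Proof.
rewrite -card_points; apply: eq_card => q.
by rewrite !inE codewordE F2_oddr_neq0.
Qed.

(** Only triples of logical rows count: three rows can cover six variables only if all of them are
    quadratic. Hence the weight modulo 8 depends on the logical part of [v] alone. *)
Lemma codeword_weight v :
  (hamming (v *m all_rows c) =
   4 * #|[set t in full_triples | t \subset supp (lsubmx v)]| %[mod 8])%N.
Proof.
rewrite hamming_codeword (weight_mod8 (mon := row_support)) ?card_ord //; last exact: card_row_support.
congr (4 * _ %% 8)%N.
have linj : injective (fun t : {set 'I_15} => lshift 7 @: t).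
  exact/imset_inj/lshift_inj.
rewrite -(card_imset _ linj); apply: eq_card => t; rewrite inE.
apply/and3P/imsetP => [[tv /eqP t3 /eqP cov]|[u]].
  pose u := [set l | lshift 7 l \in t].
  have tu : t = lshift 7 @: u.
    apply/setP => j; apply/idP/imsetP => [jt|[l]]; last by rewrite inE => lt ->.
    suff : exists l, j = lshift 7 l by case=> l ej; exists l; rewrite // inE -ej.
    rewrite -[j]fintype.splitK; case ej: (fintype.split j) => [a|s]; first by exists a.
    have {ej} ej : j = rshift 15 s by rewrite -[j]fintype.splitK ej.
    (* A triple containing a stabilizer row covers at most 1 + 2 + 2 variables. *)
    have : (#|\bigcup_(i in t) row_support i| <= 5)%N.
      rewrite (bigD1 j) //= (leq_trans (leq_card_setU _ _)) //.
      apply: (@leq_add _ _ 1 4); first by rewrite ej row_support_rshift card_low_support.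
      apply: leq_trans (_ : \sum_(i in t | i != j) 2 <= _)%N.
        apply: (big_ind2 (fun (U : {set 'I_6}) m => #|U| <= m)%N) => [|U m V m' Um Vm'|i _].
        - by rewrite finset.cards0.
        - by rewrite (leq_trans (leq_card_setU _ _)) ?leq_add.
        - exact: card_row_support.
      rewrite sum_nat_const.
      have t2 : #|t :\ j| = 2%N by have := cardsD1 j t; rewrite jt t3; case.
      apply: (@eq_leq _ (2 * 2)); congr (_ * 2)%N; apply: etrans t2.
      by apply: eq_card => i; rewrite in_setD1 andbC.
    by rewrite cov cardsT card_ord.
  exists u => //; rewrite inE full_triplesE -(card_imset _ (@lshift_inj 15 7)) -tu t3 eqxx /=.
  apply/andP; split.
    rewrite -cov [in X in _ == X]tu big_imset /=; last by move=> ? ? _ _; exact: lshift_inj.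
    by apply/eqP/eq_bigr => l _; rewrite row_support_lshift.
  apply/fintype.subsetP => l; rewrite !inE mxE => /(fintype.subsetP tv).
  by rewrite inE.
rewrite inE full_triplesE => /andP[/andP[u3 cov] uv] ->.
rewrite card_imset; last exact: lshift_inj.
split=> //; last first.
  rewrite big_imset /=; last by move=> ? ? _ _; exact: lshift_inj.
  by under eq_bigr do rewrite row_support_lshift.
apply/fintype.subsetP => _ /imsetP[l lu ->].
by have := fintype.subsetP uv l lu; rewrite !inE mxE.
Qed.

(* Moebius inversion on the face [a + U] of the cube *)
Lemma codeword_moebius v (a U : {set 'I_6}) :
  [disjoint a & U] ->
  \sum_(W in powerset U) (codeword_at v (a :|: W))%:R =
  \sum_(j in supp v) (row_support j :\: a == U)%:R :> 'F_2.
Proof.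
move=> aU.
transitivity (\sum_(W in powerset U) \sum_(j in supp v) (row_support j \subset a :|: W)%:R : 'F_2).
  by apply: eq_bigr => W _; rewrite F2_sum_natr.
rewrite exchange_big /=; apply: eq_bigr => j _.
rewrite F2_sum_natr -odd_card_interval; congr (odd _)%:R.
by apply: eq_card => W; rewrite !inE finset.subDset.
Qed.

Lemma sum_row_support (v : 'rV['F_2]_(15 + 7)) j :
  \sum_(i in supp v) (row_support i == row_support j)%:R = v 0 j.
Proof.
rewrite supp_coef; case: (boolP (j \in supp v)) => jv.
  rewrite (bigD1 j) //= eqxx big1 ?addr0 // => i /andP[_ /negbTE ij].
  by rewrite (inj_eq row_support_inj) ij.
apply: big1 => i iv; rewrite (inj_eq row_support_inj).
by case: eqP iv => // ->; rewrite (negbTE jv).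
Qed.

(** Moebius inversion over the subsets of [row_support j] recovers the coefficient of row [j] from
    the values of the codeword, here all zero. *)
Lemma quad_code_full_rank : full_rank c.
Proof.
apply: inj_row_free => v v0; apply/rowP => j; rewrite mxE -sum_row_support.
have := codeword_moebius v (a := finset.set0) (U := row_support j).
rewrite -setI_eq0 finset.set0I eqxx => /(_ isT).
under [RHS]eq_bigr do rewrite finset.setD0.
move=> <-; apply: big1 => W _; rewrite finset.set0U.
have [g _ gK] := point_bij; rewrite -[W]gK.
have := congr1 (fun u : 'rV_64 => u 0 (g W)) v0.
by rewrite codewordE mxE => ->.
Qed.

(** The cube splits into 16 faces parallel to the pair of [l]. On each, the four values sum to the
    coefficient of [l], which is 1, so the support meets every face; [x :\: pair_of l] names the
    face containing [x]. *)
Lemma hamming_quadratic (v : 'rV_(15 + 7)) (l : 'I_15) :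
  v 0 (lshift 7 l) != 0 -> (16 <= hamming (v *m all_rows c))%N.
Proof.
move=> vl; rewrite hamming_codeword.
have -> : 16%N = #|powerset (~: pair_of l)|.
  by rewrite card_powerset cardsCs finset.setCK card_pair_of card_ord.
rewrite (leq_trans _ (leq_imset_card (fun x => x :\: pair_of l) _)) //.
apply/subset_leq_card/fintype.subsetP => a; rewrite powersetE => al.
have dal : [disjoint a & pair_of l].
  rewrite fintype.disjoint_subset; apply: fintype.subset_trans al _.
  by apply/fintype.subsetP => i; rewrite !inE.
have := codeword_moebius v dal.
(* Since rows have degree at most two, a row support containing the pair has no room for a variable
   of [a], so every face sees the coefficient of [l] alone. *)
have -> : \sum_(j in supp v) (row_support j :\: a == pair_of l)%:R = v 0 (lshift 7 l).
  rewrite -sum_row_support row_support_lshift; apply: eq_bigr => j _; congr (nat_of_bool _)%:R.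
  apply/eqP/eqP => [e|->].
    apply/esym/eqP; rewrite eqEcard -{1}e finset.subsetDl.
    by rewrite card_pair_of card_row_support.
  by apply/finset.setDidPl; rewrite disjoint_sym.
move=> e; have : \sum_(W in powerset (pair_of l)) (codeword_at v (a :|: W))%:R != 0 :> 'F_2.
  by rewrite e.
apply: contraNT => /imsetP h; apply/eqP/big1 => W; rewrite powersetE => Wl.
apply/eqP; rewrite -[_ == 0]negbK F2_oddr_neq0; apply/negP => vW; apply: h.
exists (a :|: W); first by rewrite inE.
apply/setP => i; rewrite finset.in_setD finset.in_setU.
case: (boolP (i \in pair_of l)) => il /=; first by rewrite (disjointFl dal il).
suff /negbTE -> : i \notin W by rewrite orbF.
by apply: contraNN il => /(fintype.subsetP Wl).
Qed.

End Weights.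

Lemma min_weightI n (A : {set 'rV['F_2]_n}) d v :
  v \in A -> hamming v = d -> (forall u, u \in A -> d <= hamming u)%N -> min_weight A d.
Proof. by move=> vA vd lb; split=> //; exists v. Qed.

(** * Distances of the code, and faults seen as sets of points *)

Section Distances.
Variables (pt : 'I_64 -> 'rV['F_2]_6) (pt_bij : bijective pt).
Let c := quad_code pt.
Let sp q := supp (pt q).
Let sp_inj : injective sp := bij_inj (point_bij pt_bij).

Lemma spaceG0_codeword y :
  reflect (exists u, y = row_mx 0 u *m all_rows c) (y \in spaceG0 c).
Proof.
rewrite inE; apply: (iffP submxP) => -[u ->]; exists u.
  by rewrite mul_row_col mul0mx add0r.
by rewrite mul_row_col mul0mx add0r.
Qed.

Lemma quad_code_X_distance : X_distance c 16.
Proof.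
(* The monomial [x_1 x_2] attains the bound: it equals 1 on [2 ^ 4] points. *)
pose l : 'I_15 := ord0; pose y := row (lshift 7 l) (all_rows c).
have yE : y = delta_mx 0 (lshift 7 l) *m all_rows c by rewrite -rowE.
apply: (@min_weightI _ _ _ y) => [||z].
- rewrite finset.in_setD [y \in spaceG _]inE row_sub andbT.
  apply/negP => /spaceG0_codeword[u]; rewrite yE => /(row_free_inj (quad_code_full_rank pt_bij)).
  move/matrixP/(_ 0 (lshift 7 l)); rewrite row_mxEl !mxE !eqxx.
  by move/eqP; rewrite oner_eq0.
- transitivity #|[set x : {set 'I_6} | pair_of l \subset x]|.
    rewrite -(card_points pt_bij (fun x => pair_of l \subset x)); apply: eq_card => q.
    by rewrite !inE mxE all_rowsE row_support_lshift F2_oddr_neq0.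
  by rewrite card_supersets cardsCs finset.setCK card_pair_of card_ord.
- rewrite finset.in_setD [z \in spaceG _]inE => /andP[zG0 /submxP[v zE]].
  case: (pickP (fun i : 'I_15 => v 0 (lshift 7 i) != 0)) => [i vi|v0].
    by rewrite zE; exact: hamming_quadratic vi.
  case/spaceG0_codeword: zG0; exists (rsubmx v).
  rewrite zE -[v in LHS]hsubmxK; congr (row_mx _ _ *m _).
  by apply/rowP => i; rewrite !mxE; have /negbFE/eqP := v0 i.
Qed.

Definition fault_points (e : 'rV['F_2]_64) : {set {set 'I_6}} := sp @: supp e.

(** The trivial-syndrome condition: the first clause tests the constant stabilizer row, the second
    the six coordinate rows. *)
Definition zero_sum (S : {set {set 'I_6}}) :=
  ~~ odd #|S| && [forall i, ~~ odd #|[set x in S | i \in x]|].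

Lemma card_fault_points e : #|fault_points e| = hamming e.
Proof. exact: card_imset. Qed.

Lemma fault_points_bij : bijective fault_points.
Proof.
have inj : injective fault_points.
  by move=> e e' /(imset_inj sp_inj)/(bij_inj (supp_bij _)).
have [g gK Kg] := point_bij pt_bij.
exists (fun S : {set {set 'I_6}} => indicator (g @: S)) => [e|S].
  apply: inj; rewrite /fault_points indicatorK -!imset_comp.
  by apply: eq_imset => q /=; rewrite gK.
rewrite /fault_points indicatorK -imset_comp -[RHS]imset_id.
exact: eq_imset.
Qed.

Lemma dot_row e j :
  dot (row j (all_rows c)) e = (odd #|[set x in fault_points e | row_support j \subset x]|)%:R.
Proof.
rewrite dotE; congr (odd _)%:R; rewrite -(card_imset _ sp_inj).
apply: eq_card => x; rewrite inE; apply/imsetP/andP => [[q]|[/imsetP[q qe ->] jq]].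
  rewrite !inE mxE all_rowsE F2_oddr_neq0 => /andP[jq qe] ->.
  by rewrite mem_imset // inE.
exists q => //; rewrite finset.in_setI qe andbT inE mxE all_rowsE F2_oddr_neq0.
exact: jq.
Qed.

Lemma row_stab s : row s (stab_rows c) = row (rshift 15 s) (all_rows c).
Proof. by apply/rowP => q; rewrite mxE [RHS]mxE [RHS]col_mxEd. Qed.

Lemma row_logical l : row l (logical_rows c) = row (lshift 7 l) (all_rows c).
Proof. by apply/rowP => q; rewrite mxE [RHS]mxE [RHS]col_mxEu. Qed.

Lemma mem_dual_spaceG0 e : (e \in dual (spaceG0 c)) = zero_sum (fault_points e).
Proof.
rewrite mem_dual_rowspace; apply/forallP/andP => [h|[h0 /forallP h] s].
  have hs s : ~~ odd #|[set x in fault_points e | low_support s \subset x]|.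
    by have := h s; rewrite row_stab dot_row row_support_rshift -[_ == 0]negbK F2_oddr_neq0.
  split.
    have := hs (inord 6); rewrite /low_support inordK //= => h6.
    rewrite (_ : fault_points e = [set x in fault_points e | finset.set0 \subset x]) //.
    by apply/setP => x; rewrite inE finset.sub0set andbT.
  apply/forallP => i; have := hs (widen_ord (leqnSn 6) i).
  rewrite /low_support /= ltn_ord inord_val.
  rewrite (_ : [set x in fault_points e | [set i] \subset x] = [set x in fault_points e | i \in x]) //.
  by apply/setP => x; rewrite !inE finset.sub1set.
rewrite row_stab dot_row row_support_rshift -[_ == 0]negbK F2_oddr_neq0 /low_support.
case: ltnP => s6.
  by under eq_finset do rewrite finset.sub1set; exact: h.
rewrite (_ : [set x in _ | _] = fault_points e) //.
by apply/setP => x; rewrite inE finset.sub0set andbT.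
Qed.

(** An even nonzero size below 4 is 2, but two distinct points differ in some coordinate, whose sum
    is then odd. This is the minimum distance of the extended Hamming code. *)
Lemma zero_sum_ge4 S : zero_sum S -> S != finset.set0 -> (4 <= #|S|)%N.
Proof.
move=> /andP[ev /forallP h] S0; rewrite leqNgt; apply/negP => lt4.
have /cards2P[x [y [xy Sxy]]] : #|S| == 2%N.
  by move: S0 ev lt4; rewrite -cards_eq0; case: #|S| => [|[|[|[|?]]]].
have [i ixy] : exists i, (i \in x) != (i \in y).
  apply/existsP; rewrite -negb_forall; apply: contraNN xy => /forallP e.
  by apply/eqP/setP => i; apply/eqP.
have /negP := h i; apply.
wlog [ix iy] : x y xy Sxy ixy / (i \in x) /\ (i \notin y).
  move=> w; case: (boolP (i \in x)) => ix.
    by apply: (w x y) => //; split=> //; move: ixy; rewrite ix; case: (_ \in y).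
  apply: (w y x); rewrite 1?eq_sym // 1?finset.setUC //.
  by split=> //; move: ixy; rewrite (negbTE ix); case: (_ \in y).
rewrite (_ : [set z in S | i \in z] = [set x]) ?cards1 //.
apply/setP => z; rewrite Sxy inE finset.in_set1 in_set2.
by case: (eqVneq z x) => [->|_]; rewrite ?ix //=; case: eqP => // ->; rewrite (negbTE iy).
Qed.

(** The coordinate plane of the two variables of [l]. By [odd_card_interval] it is orthogonal to
    every row except that of [l], so it is a weight 4 operator acting as [Z] on the logical qubit
    [l] alone. *)
Definition face_error (l : 'I_15) : 'rV['F_2]_64 :=
  indicator (sp @^-1: powerset (pair_of l)).

Lemma fault_points_face l : fault_points (face_error l) = powerset (pair_of l).
Proof.
rewrite /fault_points indicatorK; apply/setP => x.
have [g gK Kg] := point_bij pt_bij; rewrite -[x]Kg (mem_imset _ (g x) sp_inj) inE.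
by [].
Qed.

Lemma hamming_face l : hamming (face_error l) = 4%N.
Proof. by rewrite -card_fault_points fault_points_face card_powerset card_pair_of. Qed.

Lemma dot_row_face l j : dot (row j (all_rows c)) (face_error l) = (j == lshift 7 l)%:R.
Proof.
rewrite dot_row fault_points_face odd_card_interval -row_support_lshift.
by rewrite (inj_eq row_support_inj).
Qed.

Lemma face_error_dual l : face_error l \in dual (spaceG0 c).
Proof.
rewrite mem_dual_rowspace; apply/forallP => s.
by rewrite row_stab dot_row_face eq_rlshift.
Qed.

Lemma dual_spaceG0_ge4 e : e \in dual (spaceG0 c) -> e != 0 -> (4 <= hamming e)%N.
Proof.
rewrite mem_dual_spaceG0 -card_fault_points => z0 e0; apply: zero_sum_ge4 => //.
apply: contraNneq e0 => S0; apply/eqP; apply: (bij_inj fault_points_bij); rewrite S0.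
by apply/esym/eqP; rewrite -cards_eq0 card_fault_points; apply/eqP/eq_card0 => q; rewrite !inE mxE eqxx.
Qed.

Lemma quad_code_Z_distance : Z_distance c 4.
Proof.
apply: (@min_weightI _ _ _ (face_error ord0)).
- rewrite finset.in_setD face_error_dual andbT mem_dual_rowspace.
  by apply/forallP => /(_ (lshift 7 ord0)); rewrite dot_row_face eqxx.
- exact: hamming_face.
- move=> u; rewrite finset.in_setD => /andP[uG uG0]; apply: dual_spaceG0_ge4 => //.
  apply: contraNneq uG => ->; rewrite mem_dual_rowspace; apply/forallP => j.
  by rewrite /dot big1 // => q _; rewrite [X in _ * X]mxE mulr0.
Qed.

End Distances.

(** * States of a CSS code *)


Section Signs.
Variable R : realType.
Local Notation sign := (sign R).

Lemma sign_natr (b : bool) : sign b%:R = (-1) ^+ b.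
Proof. by case: b. Qed.

Lemma signE a : sign a = (-1) ^+ (a != 0).
Proof. by rewrite {1}[a]F2_natr sign_natr. Qed.

Lemma sign0 : sign 0 = 1. Proof. exact: expr0. Qed.

Lemma signD a b : sign (a + b) = sign a * sign b.
Proof.
case: (F2_cases a) => ->; rewrite ?add0r ?sign0 ?mul1r //.
case: (F2_cases b) => ->; rewrite ?addr0 ?sign0 ?mulr1 //.
by rewrite F2_addrr sign0 /sign expr1 mulrNN mulr1.
Qed.

Lemma sign_sum (I : finType) (A : {set I}) F :
  sign (\sum_(i in A) F i) = \prod_(i in A) sign (F i).
Proof. by apply: (big_morph sign signD sign0). Qed.

Lemma conj_sign a : (sign a)^* = sign a.
Proof. by rewrite signE; case: (a != 0); rewrite ?expr0 ?expr1 ?rmorphN ?rmorph1. Qed.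

Lemma sign_mulss a : sign a * sign a = 1.
Proof. by rewrite -signD F2_addrr sign0. Qed.

Lemma omega8X4 : omega8 R ^+ 4 = -1.
Proof.
have -> : omega8 R ^+ 4 = (omega8 R * omega8 R) * (omega8 R * omega8 R) by rewrite !exprS expr0 mulr1 !mulrA.
have -> : omega8 R * omega8 R = (0 +i* 1)%C.
  rewrite /omega8; simpc; rewrite -cosD [X in (_ +i* X)%C]addrC -sinD.
  have -> : pi / 4 + pi / 4 = pi / 2 :> R by field.
  by rewrite cos_pihalf sin_pihalf.
by simpc.
Qed.

Lemma prod_T_diag n (z : 'rV['F_2]_n) : \prod_(i < n) T_diag R (z 0 i) = omega8 R ^+ hamming z.
Proof.
rewrite -card_supp -prodr_const [RHS]big_mkcond; apply: eq_bigr => i _.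
by rewrite /T_diag inE; case: eqP.
Qed.

Lemma CCZ_circuitE n (ts : {set {set 'I_n}}) (phi : state R n) :
  CCZ_circuit ts phi = diag_gate (fun z => sign (\sum_(t in ts) \prod_(l in t) z 0 l)) phi.
Proof.
apply/ffunP => z; rewrite ffunE sign_sum -big_enum /CCZ_circuit /=.
elim: (enum ts) => [|t s IH] /=; first by rewrite big_nil mul1r.
by rewrite big_cons ffunE IH mulrA.
Qed.

Lemma conj_real_complex (x : R) : (x%:C%C)^* = x%:C%C.
Proof. exact: conjc_real. Qed.

Lemma normc_sqr (x : R[i]) : (ComplexField.Normc.normc x ^+ 2)%:C%C = x^* * x.
Proof.
by rewrite rmorphXn /= mulrC -sqr_normc.
Qed.

Lemma norm2E n (psi : state R n) : (norm2 psi)%:C%C = inner psi psi.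
Proof. by rewrite /norm2 rmorph_sum /=; apply: eq_bigr => z _; rewrite normc_sqr. Qed.

End Signs.

(** * Encoding, syndrome projection and [Z] faults *)

Section CssStates.
Variables (R : realType) (k r n : nat) (c : css_matrix k r n).
Hypothesis c_full : full_rank c.
Local Notation sign := (sign R).
Local Notation encode := (@Defs.encode R k r n c).
Local Notation decode := (@Defs.decode R k r n c).
Local Notation K := (((Num.sqrt (#|spaceG0 c|%:R))^-1)%:C%C : R[i]).

Lemma G0_0 : 0 \in spaceG0 c. Proof. by rewrite inE sub0mx. Qed.

Lemma G0_D u v : u \in spaceG0 c -> v \in spaceG0 c -> u + v \in spaceG0 c.
Proof. by rewrite !inE; exact: addmx_sub. Qed.

Lemma G0_B u v : u \in spaceG0 c -> v \in spaceG0 c -> u - v \in spaceG0 c.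
Proof. by rewrite !inE => uG vG; rewrite addmx_sub // eqmx_opp. Qed.

Lemma card_G0_neq0 : #|spaceG0 c|%:R != 0 :> R[i].
Proof. by rewrite pnatr_eq0 -lt0n; apply/card_gt0P; exists 0; exact: G0_0. Qed.

(** Otherwise a nonzero combination of logical rows would lie in [spaceG0 c], against full rank. *)
Lemma logical_unique z z' y :
  y - z *m logical_rows c \in spaceG0 c -> y - z' *m logical_rows c \in spaceG0 c -> z = z'.
Proof.
move=> h /(G0_B h); rewrite opprB addrC addrA subrK -mulmxBl inE => /submxP[u e].
have : row_mx (z' - z) (- u) *m all_rows c = 0 *m all_rows c.
  by rewrite mul_row_col e mulNmx subrr mul0mx.
move/(row_free_inj c_full); rewrite -row_mx0 => /eq_row_mx[/eqP + _].
by rewrite subr_eq0 => /eqP.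
Qed.

Lemma K_sqr : #|spaceG0 c|%:R * (K * K) = 1.
Proof.
have -> : K * K = ((#|spaceG0 c|%:R)^-1)%:C%C.
  by rewrite -rmorphM /= -invfM -expr2 sqr_sqrtr.
by rewrite -[X in X * _](rmorph_nat (real_complex R)) -rmorphM /= divff //
  -(inj_eq (@complexI R)) rmorph_nat card_G0_neq0.
Qed.

(** The kets are uniform superpositions over cosets of [spaceG0 c], which are disjoint for distinct
    labels. *)
Lemma inner_logical_ket z z' :
  inner (logical_ket R c z) (logical_ket R c z') = (z == z')%:R.
Proof.
rewrite /inner; under eq_bigr do rewrite !ffunE rmorphM /= rmorph_nat conj_real_complex.
have [->|zz'] := eqVneq z z'.
  rewrite (reindex_inj (addIr (z' *m logical_rows c))) /=.
  under eq_bigr do rewrite addrK mulrACA -natrM mulnb andbb.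
  by rewrite -mulr_suml -natr_sum -big_mkcond sum1_card K_sqr.
apply: big1 => y _; rewrite mulrACA -natrM mulnb.
case: andP => [[h h']|]; last by rewrite mul0r.
by rewrite (logical_unique h h') eqxx in zz'.
Qed.

Lemma decode_encode : cancel encode decode.
Proof.
move=> phi; apply/ffunP => z; rewrite ffunE /inner.
under eq_bigr do rewrite [encode _ _]ffunE mulr_sumr.
rewrite exchange_big /= (bigD1 z) //=.
under eq_bigr do rewrite mulrCA.
rewrite -mulr_sumr [X in _ * X](inner_logical_ket z z) eqxx mulr1 big1 ?addr0 // => z' zz'.
under eq_bigr do rewrite mulrCA.
by rewrite -mulr_sumr [X in _ * X](inner_logical_ket z z') eq_sym (negbTE zz') mulr0.
Qed.

Lemma inner_encode phi psi : inner (encode phi) psi = inner phi (decode psi).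
Proof.
rewrite /inner; under eq_bigr do rewrite ffunE rmorph_sum /= mulr_suml.
rewrite exchange_big /=; apply: eq_bigr => z _; rewrite ffunE /inner mulr_sumr.
by apply: eq_bigr => y _; rewrite rmorphM /= mulrA.
Qed.

Lemma norm2_encode phi : norm2 (encode phi) = norm2 phi.
Proof. by apply/complexI; rewrite !norm2E inner_encode decode_encode. Qed.

(** A diagonal gate that is constant on each coset carrying a logical ket acts as a logical diagonal
    gate. This serves both for the transversal [T] and for [Z] faults. *)
Lemma encode_diag (D : 'rV['F_2]_n -> R[i]) (D' : 'rV['F_2]_k -> R[i]) phi :
  (forall y z, y - z *m logical_rows c \in spaceG0 c -> D y = D' z) ->
  diag_gate D (encode phi) = encode (diag_gate D' phi).
Proof.
move=> DD'; apply/ffunP => y; rewrite !ffunE mulr_sumr; apply: eq_bigr => z _.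
rewrite !ffunE; case: (boolP (_ \in _)) => [/DD' ->|_]; last by rewrite mul0r !mulr0.
by rewrite mulrA.
Qed.

Lemma dotC m (u v : 'rV['F_2]_m) : dot u v = dot v u.
Proof. by apply: eq_bigr => i _; rewrite mulrC. Qed.

Lemma dotDl m (u v w : 'rV['F_2]_m) : dot (u + v) w = dot u w + dot v w.
Proof. by rewrite -big_split; apply: eq_bigr => i _; rewrite mxE mulrDl. Qed.

(** Orthogonality of characters: if some [g0] in the subspace pairs to 1 with [e], translation by
    [g0] negates the sum. *)
Lemma sum_sign_G0 e :
  \sum_(g in spaceG0 c) sign (dot g e) = if e \in dual (spaceG0 c) then #|spaceG0 c|%:R else 0.
Proof.
rewrite [e \in _]inE; case: forall_inP => [h|/forall_inP].
  by rewrite -sum1_card natr_sum; apply: eq_bigr => g /h /eqP ->; rewrite sign0.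
rewrite negb_forall_in => /exists_inP[g0 g0G ge].
set S := \sum_(_ in _) _; have : S = - S.
  rewrite {1}/S (reindex_inj (addIr g0)) /= -sumrN.
  apply: eq_big => g; last by rewrite dotDl signD [sign (dot g0 e)]signE ge mulrN1.
  apply/idP/idP => [h|gG]; last exact: G0_D.
  by rewrite -[g](addrK g0); exact: G0_B.
by move/eqP; rewrite -addr_eq0 -mulr2n mulrn_eq0 /= => /eqP.
Qed.

(** A stabilizer [X^g] fixes the encoded state and commutes with [Z^e] up to the sign of [dot g e],
    so the projection multiplies the state by the average of these signs. *)
Lemma trivial_syndrome_encode e phi :
  trivial_syndrome c (pauliZ e (encode phi)) =
  if e \in dual (spaceG0 c) then pauliZ e (encode phi) else [ffun=> 0].
Proof.
apply/ffunP => y; rewrite ffunE.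
have -> : \sum_(g in spaceG0 c) pauliX g (pauliZ e (encode phi)) y =
    pauliZ e (encode phi) y * \sum_(g in spaceG0 c) sign (dot g e).
  rewrite mulr_sumr; apply: eq_bigr => g gG; rewrite [LHS]ffunE [LHS]ffunE [in RHS]ffunE.
  have -> : encode phi (y - g) = encode phi y.
    by rewrite -[in RHS](encode_Xstab phi gG) [RHS]ffunE.
  rewrite [RHS]mulrAC; congr (_ * _).
  rewrite -[in RHS](subrK g y).
  by rewrite [dot e (_ + g)]dotC dotDl signD -mulrA sign_mulss mulr1 dotC.
rewrite sum_sign_G0; case: ifP => _; first by rewrite mulfK // card_G0_neq0.
by rewrite mulr0 mul0r ffunE.
Qed.

(** The vector [s] for which [Z^e] acts on the code as logical [Z^s], provided the syndrome of [e]
    is trivial. *)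
Definition logical_fault (e : 'rV['F_2]_n) : 'rV['F_2]_k :=
  \row_l dot (row l (logical_rows c)) e.

Lemma dot_logical e z : dot (logical_fault e) z = dot e (z *m logical_rows c).
Proof.
rewrite /dot; under [RHS]eq_bigr do rewrite mxE mulr_sumr.
rewrite exchange_big /=; apply: eq_bigr => l _.
rewrite mxE /dot mulr_suml; apply: eq_bigr => q _.
by rewrite mxE [RHS]mulrC [z 0 l * _]mulrC mulrAC.
Qed.

Lemma pauliZ_encode e phi : e \in dual (spaceG0 c) ->
  pauliZ e (encode phi) = encode (pauliZ (logical_fault e) phi).
Proof.
rewrite inE => /forall_inP eG; apply: encode_diag => y z yz.
rewrite -[y](subrK (z *m logical_rows c)) [dot e _]dotC dotDl (eqP (eG _ yz)) add0r.
by rewrite dotC dot_logical.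
Qed.

Variables (V : state R k -> state R k) (input : state R k).
Hypothesis TV : implements (R := R) c (@transversal_T R n) V.

Lemma accepted_stateE e : accepted_state c input e =
  if e \in dual (spaceG0 c) then encode (pauliZ (logical_fault e) (V input)) else [ffun=> 0].
Proof.
rewrite /accepted_state TV trivial_syndrome_encode.
by case: ifP => // /pauliZ_encode.
Qed.

Lemma norm2_pauliZ m s (phi : state R m) : norm2 (pauliZ s phi) = norm2 phi.
Proof.
apply: eq_bigr => z _; rewrite ffunE; apply/complexI; rewrite !normc_sqr.
by rewrite rmorphM /= conj_sign mulrACA sign_mulss mul1r.
Qed.

Lemma norm2_0 m : norm2 ([ffun=> 0] : state R m) = 0.
Proof. by apply: big1 => z _; rewrite ffunE ComplexField.Normc.normc0 expr0n. Qed.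

Lemma accept_probE e :
  accept_prob c input e = if e \in dual (spaceG0 c) then norm2 (V input) else 0.
Proof.
rewrite /accept_prob accepted_stateE; case: ifP => _; last exact: norm2_0.
by rewrite norm2_encode norm2_pauliZ.
Qed.

Lemma output_stateE e : output_state c input e =
  if e \in dual (spaceG0 c) then pauliZ (logical_fault e) (V input) else [ffun=> 0].
Proof.
rewrite /output_state accepted_stateE; case: ifP => _; first exact: decode_encode.
by apply/ffunP => z; rewrite !ffunE /inner big1 // => y _; rewrite !ffunE mulr0.
Qed.

End CssStates.

(** * The CCZ circuit and its restriction *)

Lemma quad_code_implements (R : realType) pt (pt_bij : bijective pt) :
  implements (R := R) (quad_code pt) (@transversal_T R 64) (CCZ_circuit full_triples).
Proof.
move=> phi; rewrite CCZ_circuitE; apply: encode_diag => y z yz.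
rewrite prod_T_diag.
have [u yE] : exists u, y = row_mx z u *m all_rows (quad_code pt).
  move: yz; rewrite inE => /submxP[u e]; exists u.
  by rewrite mul_row_col -e addrC subrK.
have := codeword_weight pt_bij (row_mx z u); rewrite -yE row_mxKl.
have -> : \sum_(t in full_triples) \prod_(l in t) z 0 l =
    (odd #|[set t in full_triples | t \subset supp z]|)%:R.
  rewrite -F2_sum_natr; apply: eq_bigr => t _; rewrite F2_prod_natr; congr (nat_of_bool _)%:R.
  by apply/forall_inP/fintype.subsetP => h l /h; rewrite inE.
move: #|_| => N hN.
(* As [omega8 ^+ 8 = 1], only the weight modulo 8 matters. *)
have mod8 m : omega8 R ^+ m = omega8 R ^+ (m %% 8).
  rewrite {1}(divn_eq m 8) exprD (mulnC _ 8) exprM.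
  by rewrite (exprM _ 4 2) omega8X4 sqrrN expr1n expr1n mul1r.
by rewrite sign_natr signr_odd -omega8X4 -exprM mod8 hN -mod8.
Qed.

(** * Full triples avoiding the zeroed qubits *)

Definition index_set (s : seq nat) : {set 'I_15} := [set l : 'I_15 | val l \in s].

(** Passes from one-based labels to a zero-based test on natural numbers, on which the finite checks
    compute. *)
Lemma lqsE ms : all (fun m => 0 < m <= 15)%N ms -> lqs ms = index_set (map predn ms).
Proof.
move=> /allP ok; apply/setP => l; rewrite !inE; apply/mapP/mapP => -[m mms].
  by move=> ->; exists m => //=; rewrite inordK //; have := ok m mms; lia.
move=> lm; exists m => //; apply: val_inj => /=; rewrite inordK //.
by have := ok m mms; lia.
Qed.

Lemma prod_index_set (F : 'I_15 -> 'F_2) s :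
  uniq s -> all (fun k => k < 15)%N s ->
  \prod_(l in index_set s) F l = \prod_(k <- s) F (inord k).
Proof.
move=> us /allP s15; rewrite -(big_map inord xpredT F).
rewrite big_uniq /=; last first.
  by rewrite map_inj_in_uniq // => a b /s15 a15 /s15 b15 /(congr1 val) /=; rewrite !inordK.
apply: eq_bigl => l; rewrite inE; apply/idP/mapP => [ls|[k ks ->]].
  by exists (val l); rewrite ?inord_val.
by rewrite /= inordK ?s15.
Qed.

Lemma card_index_set s :
  uniq s -> all (fun k => k < 15)%N s -> #|index_set s| = size s.
Proof.
move=> us /allP s15; rewrite -(size_map (inord : nat -> 'I_15)).
rewrite -(card_uniqP _); last first.
  by rewrite map_inj_in_uniq // => a b /s15 a15 /s15 b15 /(congr1 val) /=; rewrite !inordK.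
apply: eq_card => l; rewrite inE; apply/idP/mapP => [ls|[k ks ->]].
  by exists (val l); rewrite ?inord_val.
by rewrite /= inordK ?s15.
Qed.

Definition zeroed_qubits : {set 'I_15} := lqs [:: 3; 4; 7; 8; 12]%N.

(* The triples of [full_triples] that avoid the zeroed qubits; logical qubits are
   numbered from 0 here, as the elements of ['I_15] are. *)
Definition surviving : seq (seq nat) :=
  [:: [:: 9; 14; 0]; [:: 0; 10; 13]; [:: 1; 8; 12]; [:: 12; 4; 5]]%N.

Lemma zeroedE : zeroed_qubits = index_set [:: 2; 3; 6; 7; 11]%N.
Proof. by rewrite /zeroed_qubits lqsE. Qed.

Lemma pair_ofE (l : 'I_15) (i : 'I_6) :
  (i \in pair_of l) = (let ij := nth (0, 0)%N lex_pairs l in (i.+1 == ij.1) || (i.+1 == ij.2)).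
Proof.
have := lex_pairs_lt l; rewrite /pair_of; case: (nth _ _ l) => a b /= h.
rewrite in_set2 -!(inj_eq val_inj) /= !inordK; try lia.
Qed.

Definition covering (s : seq nat) :=
  all (fun v => has (fun l => let ij := nth (0, 0)%N lex_pairs l in (v == ij.1) || (v == ij.2)) s)
      (iota 1 6).

Definition kept : seq nat := [seq l <- iota 0 15 | l \notin [:: 2; 3; 6; 7; 11]]%N.

(** Exhaustive check over ordered triples of the ten kept qubits. Triples with a repetition involve
    at most four variables, so they never cover. *)
Lemma covering_kept : all (fun a => all (fun b => all (fun d =>
  covering [:: a; b; d] ==> has (perm_eq [:: a; b; d]) surviving) kept) kept) kept.
Proof. by vm_compute. Qed.

Lemma surviving_covering :
  all (fun s => [&& covering s, uniq s, size s == 3 & all (mem kept) s])%N surviving.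
Proof. by vm_compute. Qed.

(** Ensures that the four lists give four different sets, so that a sum over the list counts each
    triple once. *)
Lemma surviving_sep : all (fun s : seq nat => all (fun s' : seq nat =>
  all (fun k => (k \in s) == (k \in s')) (iota 0 15) ==> (s == s')) surviving) surviving.
Proof. by vm_compute. Qed.

Lemma index_set_perm (s s' : seq nat) : perm_eq s s' -> index_set s = index_set s'.
Proof. by move=> e; apply/setP => l; rewrite !inE (perm_mem e). Qed.

Lemma mem_kept (l : 'I_15) : (val l \in kept) = (l \notin zeroed_qubits).
Proof. by rewrite mem_filter mem_iota add0n leq0n ltn_ord /= andbT zeroedE [l \in index_set _]inE. Qed.

Lemma index_set_cover s :
  all (fun k => k < 15)%N s ->
  (\bigcup_(l in index_set s) pair_of l == [set: 'I_6]%SET) = covering s.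
Proof.
move=> /allP s15; apply/eqP/allP => [cov v|cov].
  rewrite mem_iota => v6; have v6' : (v.-1 < 6)%N by lia.
  have : Ordinal v6' \in \bigcup_(l in index_set s) pair_of l by rewrite cov inE.
  case/bigcupP => l; rewrite inE pair_ofE /= prednK; last by lia.
  by move=> ls vl; apply/hasP; exists (val l).
apply/setP => i; rewrite finset.in_setT; apply/bigcupP.
have /hasP[k ks ki] : has (fun l => let ij := nth (0, 0)%N lex_pairs l in (i.+1 == ij.1) || (i.+1 == ij.2)) s.
  by apply: cov; rewrite mem_iota /= ltnS ltn_ord.
exists (inord k); first by rewrite inE /= inordK ?s15.
by rewrite pair_ofE inordK ?s15.
Qed.

Lemma full_triples_surviving t :
  (t \in full_triples) && [disjoint t & zeroed_qubits] = (t \in [seq index_set s | s <- surviving]).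
Proof.
apply/andP/mapP => [[]|[s sS ->]].
  rewrite full_triplesE => /andP[t3 cov] tz.
  have [a [b [d tE]]] : exists a b d : 'I_15, t = [set a; b; d].
    have /card_gt0P[a ta] : (0 < #|t|)%N by rewrite (eqP t3).
    have : #|t :\ a| == 2%N by have := cardsD1 a t; rewrite ta (eqP t3) add1n => -[<-].
    case/cards2P => b [d [_ e]]; exists a, b, d.
    by rewrite -(finset.setD1K ta) e finset.setUA.
  have tI : t = index_set [:: val a; val b; val d].
    by rewrite tE; apply/setP => l; rewrite !inE -!(inj_eq val_inj) orbA.
  have kp x : x \in t -> val x \in kept by move=> xt; rewrite mem_kept (disjointFr tz xt).
  have /hasP[s sS ps] : has (perm_eq [:: val a; val b; val d]) surviving.
    have /allP/(_ (val a))/(_ (kp a _))/allP/(_ (val b))/(_ (kp b _))/allP/(_ (val d))/(_ (kp d _)) := covering_kept.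
    move=> /(_ _ _ _)/implyP; apply; rewrite ?tE ?inE ?eqxx ?orbT //.
    by rewrite -index_set_cover -?tI //= !ltn_ord.
  by exists s; rewrite // tI; apply: index_set_perm.
have /allP/(_ s sS)/and4P[cs us s3 /allP sk] := surviving_covering.
have s15 : all (fun k => k < 15)%N s.
  by apply/allP => k /sk; rewrite /= mem_filter mem_iota => /andP[].
split; last first.
  by apply/pred0P => l /=; apply/negbTE; rewrite negb_and -mem_kept inE; case: (boolP (_ \in s)) => //= /sk.
by rewrite full_triplesE index_set_cover // cs andbT card_index_set.
Qed.

Lemma uniq_surviving : uniq [seq index_set s | s <- surviving].
Proof.
rewrite map_inj_in_uniq // => s s' sS sS' /setP e.
have /allP/(_ s sS)/allP/(_ s' sS')/implyP := surviving_sep.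
move=> h; apply/eqP/h/allP => k; rewrite mem_iota => k15.
by have := e (inord k); rewrite !inE /= inordK // => ->.
Qed.

(** The middle entry is the qubit shared by the two [CCZ] gates: number 0, [x_1 x_2], in [fwires]
    and number 12, [x_4 x_5], in [gwires]. *)
Definition fwires (i : 'I_5) : 'I_15 := inord (nth 0 [:: 9; 14; 0; 10; 13] i)%N.
Definition gwires (i : 'I_5) : 'I_15 := inord (nth 0 [:: 1; 8; 12; 4; 5] i)%N.

Lemma inord_nth_inj (s : seq nat) :
  uniq s -> all (fun k => k < 15)%N s -> size s = 5%N ->
  injective (fun i : 'I_5 => inord (nth 0%N s i) : 'I_15).
Proof.
move=> us s15 s5 i j /(congr1 val) /=.
rewrite !inordK ?(all_nthP 0%N s15) ?s5 // => /eqP.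
by rewrite nth_uniq ?s5 // => /eqP /val_inj.
Qed.

Lemma imset_inord_nth (s : seq nat) :
  all (fun k => k < 15)%N s -> size s = 5%N ->
  [set (inord (nth 0%N s i) : 'I_15) | i : 'I_5] = index_set s.
Proof.
move=> s15 s5; apply/setP => l; rewrite inE; apply/imsetP/idP => [[i _ ->]|ls].
  by rewrite /= inordK ?(all_nthP 0%N s15) ?mem_nth ?s5.
have l5 : (index (val l) s < 5)%N by move: ls; rewrite -index_mem s5.
by exists (Ordinal l5) => //=; rewrite nth_index // inord_val.
Qed.

(** * Restriction of the circuit and overlaps with the target *)

Section Target.
Variable R : realType.
Local Notation sign := (sign R).

Lemma CCZ_zero_on n (A t : {set 'I_n}) (phi : state R n) :
  zero_on A phi -> ~~ [disjoint t & A] -> CCZ t phi = phi.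
Proof.
move=> phi0 /pred0Pn[l /andP[lt lA]]; apply/ffunP => z; rewrite ffunE.
have [->|/phi0 z0] := eqVneq (phi z) 0; first by rewrite mulr0.
by rewrite (bigD1 l) //= z0 // mul0r sign0 mul1r.
Qed.

Lemma TOFs_diagE (s : seq nat) (z : 'rV['F_2]_15) :
  TOFs_diag R (wires (fun i : 'I_5 => inord (nth 0%N s i)) z) =
  let z_ i := z 0 (inord (nth 0%N s i)) in
  sign (z_ 0%N * z_ 1%N * z_ 2%N + z_ 2%N * z_ 3%N * z_ 4%N).
Proof. by rewrite /TOFs_diag !mxE !inordK. Qed.

(** On the basis states occurring in [phi], a triple meeting the zeroed qubits contributes 0 to the
    exponent. The four surviving triples group in twos by their shared qubit. *)
Lemma CCZ_circuit_zeroed (phi : state R 15) : zero_on zeroed_qubits phi ->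
  CCZ_circuit full_triples phi = TOFs_on fwires (TOFs_on gwires phi).
Proof.
move=> phi0; rewrite CCZ_circuitE; apply/ffunP => z; rewrite !ffunE.
have [->|/phi0 z0] := eqVneq (phi z) 0; first by rewrite !mulr0.
rewrite [RHS]mulrA; congr (_ * _); rewrite !TOFs_diagE /= -signD; congr (sign _).
rewrite (bigID (fun t : {set 'I_15} => [disjoint t & zeroed_qubits])) /= [X in _ + X]big1 => [|t]; last first.
  by case/andP => _ /pred0Pn[l /andP[lt lA]]; rewrite (bigD1 l) //= z0 // mul0r.
rewrite addr0 (eq_bigl _ _ full_triples_surviving) -big_uniq ?uniq_surviving //=.
rewrite !big_cons big_nil !prod_index_set // !big_cons !big_nil.
by rewrite !mulr1 addr0 -!addrA !mulrA.
Qed.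

Lemma zero_plus_zero_on n (A : {set 'I_n}) : zero_on A (zero_plus_state R A).
Proof.
move=> z; rewrite ffunE => h l lA; apply/eqP; apply: contraNT h => zl.
by rewrite (bigD1 l) //= lA (negbTE zl) mul0r.
Qed.

Lemma card_zeroed : #|zeroed_qubits| = 5%N.
Proof. by rewrite zeroedE card_index_set. Qed.

Lemma target_product :
  TOFs_on fwires (TOFs_on gwires (zero_plus_state R zeroed_qubits)) =
  product_state fwires gwires zeroed_qubits (magic_state (TOFs_diag R)) (magic_state (TOFs_diag R)).
Proof.
apply/ffunP => z; rewrite !ffunE.
have -> : \prod_(l < 15) (if l \in zeroed_qubits then (z 0 l == 0)%:R else ((Num.sqrt 2)^-1)%:C%C : R[i]) =
    \prod_(l in zeroed_qubits) (z 0 l == 0)%:R * ((Num.sqrt 2)^-1)%:C%C ^+ 10.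
  rewrite (bigID (mem zeroed_qubits)) /=; congr (_ * _); first by apply: eq_bigr => l ->.
  rewrite (eq_bigr (fun=> ((Num.sqrt 2)^-1)%:C%C)); last by move=> l /negbTE ->.
  rewrite prodr_const; congr (_ ^+ _).
  by have := cardC (mem zeroed_qubits); rewrite card_zeroed card_ord => -[].
(* The ten qubits in the plus state are shared out, five to each magic state. *)
rewrite -[10%N]/(5 + 5)%N exprD.
move: (_ ^+ 5) (\prod_(_ in _) _) (TOFs_diag _ _) (TOFs_diag _ _) => a b d d'.
ring.
Qed.

Lemma zero_plus_conj n (A : {set 'I_n}) z :
  Num.conj (zero_plus_state R A z) = zero_plus_state R A z.
Proof.
rewrite ffunE rmorph_prod; apply: eq_bigr => l _.
by case: ifP => _; [exact: rmorph_nat | exact: conj_real_complex].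
Qed.

Lemma inner_pauliZ_diag n (h : 'rV['F_2]_n -> 'F_2) s (phi : state R n) :
  inner (diag_gate (fun z => sign (h z)) phi) (pauliZ s (diag_gate (fun z => sign (h z)) phi)) =
  inner phi (pauliZ s phi).
Proof.
apply: eq_bigr => z _; rewrite !ffunE rmorphM /= conj_sign.
by rewrite [sign (dot s z) * _]mulrCA mulrACA sign_mulss mul1r.
Qed.

(** The inner product factors over the qubits: [Z] fixes the zero state and sends the plus state to
    an orthogonal one. *)
Lemma inner_pauliZ_zero_plus n (A : {set 'I_n}) s :
  inner (zero_plus_state R A) (pauliZ s (zero_plus_state R A)) = (supp s \subset A)%:R.
Proof.
(* The contribution of qubit [l]: its squared amplitude times the sign produced by the fault. *)
pose w l (b : 'F_2) : R[i] := (if l \in A then (b == 0)%:R else 2^-1) * sign (s 0 l * b).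
transitivity (\sum_(z : 'rV['F_2]_n) \prod_(l < n) w l (z 0 l)).
  apply: eq_bigr => z _; rewrite zero_plus_conj !ffunE mulrCA mulrC big_split /=; congr (_ * _).
    rewrite -big_split; apply: eq_bigr => l _ /=; case: ifP => _.
      by rewrite -natrM mulnb andbb.
    by rewrite -rmorphM /= -invfM -expr2 sqr_sqrtr // fmorphV rmorph_nat.
  by apply: (big_morph sign (@signD R) (@sign0 R)).
transitivity (\sum_(z : {ffun 'I_n -> 'F_2}) \prod_(l < n) w l (z l)).
  rewrite (reindex (fun z : {ffun 'I_n -> 'F_2} => \row_l z l)) /=.
    by apply: eq_bigr => z _; apply: eq_bigr => l _; rewrite mxE.
  exists (fun z : 'rV_n => [ffun l => z 0 l]) => z _.
    by apply/ffunP => l; rewrite ffunE mxE.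
  by apply/rowP => l; rewrite mxE ffunE.
rewrite -bigA_distr_bigA /=.
have F2sum (F : 'F_2 -> R[i]) : \sum_b F b = F 0 + F 1.
  rewrite (bigD1 0) //= (bigD1 1) //= big1 ?addr0 // => b /andP[].
  by case: (F2_cases b) => ->; rewrite eqxx.
have half2 : 2^-1 + 2^-1 = 1 :> R[i] by rewrite [RHS]splitr div1r.
have wl l : \sum_b w l b = ((l \in supp s) ==> (l \in A))%:R.
  rewrite F2sum /w mulr0 mulr1 sign0 mulr1 inE signE; case: ifP => _.
    by rewrite eqxx oner_eq0 mul0r addr0 implybT.
  by case: (s 0 l != 0); rewrite ?expr1 ?expr0 ?mulrN mulr1 ?subrr // half2.
under eq_bigr do rewrite wl.
case: fintype.subsetP => [h|/fintype.subsetP].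
  by apply: big1 => l _; case: implyP => // -[/h].
by case/subsetPn => l ls lA; rewrite (bigD1 l) //= ls (negbTE lA) mul0r.
Qed.

(** * Acceptance and success under a given fault *)

Section Faults.
Variables (pt : 'I_64 -> 'rV['F_2]_6) (pt_bij : bijective pt).
Let c := quad_code pt.
Let input := zero_plus_state R zeroed_qubits.
Let target := product_state fwires gwires zeroed_qubits (magic_state (TOFs_diag R)) (magic_state (TOFs_diag R)).

Lemma CCZ_circuit_input : CCZ_circuit full_triples input = target.
Proof. by rewrite CCZ_circuit_zeroed ?target_product //; exact: zero_plus_zero_on. Qed.

Lemma inner_target s : inner target (pauliZ s target) = (supp s \subset zeroed_qubits)%:R.
Proof. by rewrite -CCZ_circuit_input CCZ_circuitE inner_pauliZ_diag inner_pauliZ_zero_plus. Qed.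

Lemma pauliZ0 n (phi : state R n) : pauliZ 0 phi = phi.
Proof.
apply/ffunP => z; rewrite ffunE /dot big1 ?sign0 ?mul1r // => i _.
by rewrite mxE mul0r.
Qed.

Lemma supp0 n : supp (0 : 'rV['F_2]_n) = finset.set0.
Proof. by apply/setP => i; rewrite !inE mxE eqxx. Qed.

Lemma norm2_target : norm2 target = 1.
Proof.
by apply: complexI; rewrite norm2E -[X in inner _ X]pauliZ0 inner_target supp0 finset.sub0set.
Qed.

Lemma quad_accept_prob e : accept_prob c input e = (e \in dual (spaceG0 c))%:R.
Proof.
rewrite (accept_probE (quad_code_full_rank pt_bij) _ (quad_code_implements pt_bij)).
by rewrite CCZ_circuit_input norm2_target; case: ifP.
Qed.

(** An accepted output equals the target up to [Z] on the faulty logical qubits. Its overlap with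
    the target is 1 if these are all zeroed and 0 otherwise. *)
Lemma quad_success_prob e : success_prob c input target e =
  ((e \in dual (spaceG0 c)) && (supp (logical_fault c e) \subset zeroed_qubits))%:R.
Proof.
rewrite /success_prob (output_stateE (quad_code_full_rank pt_bij) _ (quad_code_implements pt_bij)).
rewrite CCZ_circuit_input; case: ifP => _ /=.
  rewrite inner_target; case: (_ \subset _).
    by rewrite ComplexField.Normc.normc1 expr1n.
  by rewrite ComplexField.Normc.normc0 expr0n.
rewrite /inner big1 ?ComplexField.Normc.normc0 ?expr0n // => z _.
by rewrite !ffunE mulr0.
Qed.

Lemma logical_fault0 : logical_fault c 0 = 0.
Proof. by apply/rowP => l; rewrite !mxE /dot big1 // => i _; rewrite [X in _ * X]mxE mulr0. Qed.

Lemma dual0 : 0 \in dual (spaceG0 c).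
Proof.
by rewrite inE; apply/forall_inP => u _; rewrite /dot big1 // => i _; rewrite mxE mulr0.
Qed.

Lemma quad_output_state : output_state c input 0 = target.
Proof.
rewrite (output_stateE (quad_code_full_rank pt_bij) _ (quad_code_implements pt_bij)) dual0.
by rewrite logical_fault0 pauliZ0 CCZ_circuit_input.
Qed.

Lemma mem_failures e : (e \in undetected_failures c input target) =
  (e \in dual (spaceG0 c)) && ~~ (supp (logical_fault c e) \subset zeroed_qubits).
Proof.
rewrite inE quad_success_prob quad_accept_prob ltr_nat.
by case: (_ \in dual _); case: (_ \subset _).
Qed.

Lemma failures_ge4 e : e \in undetected_failures c input target -> (4 <= hamming e)%N.
Proof.
rewrite mem_failures => /andP[eG es]; apply: (dual_spaceG0_ge4 pt_bij) => //.
by apply: contraNneq es => ->; rewrite logical_fault0 supp0 finset.sub0set.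
Qed.

Lemma quad_protocol_distance : protocol_distance c input target 4.
Proof.
(* Logical qubit [ord0], that of [x_1 x_2], is not zeroed, so its weight 4 operator is a failure. *)
apply: (@min_weightI _ _ _ (face_error pt ord0)).
- rewrite mem_failures face_error_dual //; apply/subsetPn; exists ord0.
    by rewrite inE mxE row_logical dot_row_face // eqxx.
  by rewrite zeroedE inE.
- exact: hamming_face.
- exact: failures_ge4.
Qed.

End Faults.
End Target.

(** * Counting the failing faults of weight 4 *)

(** Addition of vectors over [F_2], carried over to supports. *)
Definition symdiff (T : finType) (x y : {set T}) : {set T} := [set i | (i \in x) (+) (i \in y)].

Lemma in_symdiff (T : finType) (x y : {set T}) i : (i \in symdiff x y) = (i \in x) (+) (i \in y).
Proof. by rewrite inE. Qed.

Lemma symdiffK (T : finType) (a : {set T}) : involutive (symdiff a).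
Proof. by move=> x; apply/setP => i; rewrite !in_symdiff addKb. Qed.

Lemma symdiff_eq0 (T : finType) (x y : {set T}) : (symdiff x y == finset.set0) = (x == y).
Proof.
apply/eqP/eqP => [/setP e|->]; apply/setP => i; last by rewrite in_symdiff addbb inE.
by have := e i; rewrite in_symdiff finset.in_set0; do 2 case: (i \in _).
Qed.

Lemma card_filter_seq (T : finType) (s : seq T) (P : pred T) :
  uniq s -> #|[set x in [set:: s] | P x]| = count P s.
Proof.
move=> us; rewrite -size_filter -(card_uniqP (filter_uniq P us)).
by apply: eq_card => x; rewrite mem_filter !inE andbC.
Qed.

(** * Affine planes and wedge products *)

Section Planes.
Implicit Types (a b d u v : {set 'I_6}) (S : {set {set 'I_6}}).

(** The affine plane through three distinct points; over [F_2] the fourth point is their sum. *)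
Definition plane a b d : seq {set 'I_6} := [:: a; b; d; symdiff a (symdiff b d)].

Lemma uniq_plane a b d : uniq [:: a; b; d] -> uniq (plane a b d).
Proof.
rewrite /plane /= !inE => /and3P[/norP[ab ad] bd _].
rewrite !negb_or ab ad bd /= andbT.
apply/and3P; split.
- apply: contraNneq bd => /setP e; rewrite -symdiff_eq0; apply/eqP/setP => i.
  by have := e i; rewrite !in_symdiff finset.in_set0; do 3 case: (i \in _).
- apply: contraNneq ad => /setP e; rewrite -symdiff_eq0; apply/eqP/setP => i.
  by have := e i; rewrite !in_symdiff finset.in_set0; do 3 case: (i \in _).
- apply: contraNneq ab => /setP e; rewrite -symdiff_eq0; apply/eqP/setP => i.
  by have := e i; rewrite !in_symdiff finset.in_set0; do 3 case: (i \in _).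
Qed.

Lemma zero_sum_plane a b d : uniq [:: a; b; d] -> zero_sum [set:: plane a b d].
Proof.
move=> /uniq_plane us; apply/andP; split.
  by rewrite cardsE (card_uniqP us).
apply/forallP => i; rewrite card_filter_seq // /= !in_symdiff.
by do 3 case: (i \in _).
Qed.

(** The vanishing sum forces the fourth point. With [zero_sum_plane], the zero-sum sets of size 4
    are exactly the affine planes. *)
Lemma zero_sum_card4 a b d S : uniq [:: a; b; d] ->
  zero_sum S -> #|S| = 4%N -> all (mem S) [:: a; b; d] -> S = [set:: plane a b d].
Proof.
move=> us /andP[_ /forallP zS] S4 /and4P[aS bS dS _].
pose A := [set:: [:: a; b; d]].
have AS : A \subset S.
  by apply/fintype.subsetP => x; rewrite inE /= !inE => /or3P[]/eqP->.
have A3 : #|A| = 3%N by rewrite cardsE (card_uniqP us).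
have /cards1P[e eS] : #|S :\: A| == 1%N by rewrite cardsDS // S4 A3.
have SE : S = [set:: [:: a; b; d; e]].
  rewrite -(finset.setID S A) eS (finset.setIidPr AS).
  by apply/setP => x; rewrite !inE /= -!orbA.
have ue : uniq [:: a; b; d; e].
  have : e \in S :\: A by rewrite eS finset.in_set1.
  rewrite finset.in_setD => /andP[eA _]; move: us eA.
  by rewrite /A !inE /= !inE !negb_or ![e == _]eq_sym => /and3P[/andP[-> ->] -> _] /and3P[-> -> ->].
rewrite SE; suff -> : e = symdiff a (symdiff b d) by [].
apply/setP => i.
have := zS i; rewrite SE card_filter_seq // /= !in_symdiff.
by do 4 case: (i \in _).
Qed.

(** The Pluecker coordinate of [u] and [v] at the pair of [l], a 2 by 2 minor over [F_2]. *)
Definition wedge (l : 'I_15) u v :=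
  let ij := nth (0, 0)%N lex_pairs l in
  let i : 'I_6 := inord ij.1.-1 in let j : 'I_6 := inord ij.2.-1 in
  ((i \in u) && (j \in v)) (+) ((j \in u) && (i \in v)).

(** The sum of [x_i x_j] over the plane is its second difference in the two directions, which is
    independent of the base point because the degree is two. *)
Lemma odd_pair_plane l a b d : uniq [:: a; b; d] ->
  odd #|[set x in [set:: plane a b d] | pair_of l \subset x]| =
  wedge l (symdiff a b) (symdiff a d).
Proof.
move=> us; rewrite card_filter_seq ?uniq_plane //= /wedge /pair_of.
case: (nth _ _ l) => i j /=; rewrite !finset.subUset !finset.sub1set !in_symdiff.
by do 6 case: (_ \in _).
Qed.

(** The first three clauses say that [u] and [v] are linearly independent over [F_2]. *)
Definition failing_plane u v :=
  [&& u != finset.set0, v != finset.set0, u != v & [exists l, (l \notin zeroed_qubits) && wedge l u v]].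

Definition failing S :=
  [&& zero_sum S, #|S| == 4%N &
   [exists l, (l \notin zeroed_qubits) && odd #|[set x in S | pair_of l \subset x]|]].

(** Three distinct points lie in a single affine plane, so at most one failing set contains them. *)
Lemma card_failing_above a b d :
  #|[set S | failing S & all (mem S) [:: a; b; d] && uniq [:: a; b; d]]| =
  failing_plane (symdiff a b) (symdiff a d).
Proof.
have uE : uniq [:: a; b; d] = [&& symdiff a b != finset.set0, symdiff a d != finset.set0 & symdiff a b != symdiff a d].
  by rewrite !symdiff_eq0 (inj_eq (inv_inj (symdiffK a))) /= !inE negb_or -!andbA andbT.
case: (boolP (uniq [:: a; b; d])) => us; last first.
  rewrite (_ : [set S | _] = finset.set0) ?finset.cards0.
    by move: us; rewrite uE /failing_plane; do 3 case: (_ == _).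
  by apply/setP => S; rewrite inE !andbF finset.in_set0.
have -> : failing_plane (symdiff a b) (symdiff a d) = failing [set:: plane a b d].
  rewrite /failing_plane /failing zero_sum_plane // cardsE (card_uniqP (uniq_plane us)) /=.
  rewrite andbA andbA -[X in X && _]andbA -uE us /=.
  by apply: eq_existsb => l; rewrite odd_pair_plane.
case: (boolP (failing _)) => fp.
  rewrite (_ : [set S | _] = [set [set:: plane a b d]]) ?cards1 //.
  apply/setP => S; rewrite inE finset.in_set1 andbT; apply/andP/eqP => [[/and3P[zS /eqP S4 _] aS]|->].
    exact: zero_sum_card4.
  by split=> //; rewrite /= !inE !eqxx ?orbT.
rewrite (_ : [set S | _] = finset.set0) ?finset.cards0 //.
apply/setP => S; rewrite !inE andbT; apply/negbTE; apply: contraNN fp => /andP[fS aS].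
by have /and3P[zS /eqP S4 _] := fS; rewrite -(zero_sum_card4 us zS S4 aS).
Qed.

(* Each failing set of 4 points contains 24 ordered triples of distinct points,
   and a triple is given by a point and two directions. *)
Lemma card_failing :
  (#|[set S | failing S]| * 24 = 64 * \sum_u \sum_v failing_plane u v)%N.
Proof.
transitivity (\sum_(S | failing S) #|[set t : 3.-tuple {set 'I_6} | all (mem S) t & uniq t]|)%N.
  rewrite -sum1_card big_distrl /=; apply: eq_big => [S|S]; first by rewrite inE.
  by rewrite inE card_uniq_tuples => /and3P[_ /eqP -> _].
transitivity (\sum_(t : 3.-tuple {set 'I_6})
    #|[set S | failing S & all (mem S) t && uniq t]|)%N.
  under eq_bigr do rewrite -sum1_card big_mkcond /=.
  rewrite exchange_big /=; apply: eq_bigr => t _.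
  rewrite -sum1_card [RHS]big_mkcond [LHS]big_mkcond /=; apply: eq_bigr => S _.
  by rewrite !inE; case: (failing S).
transitivity (\sum_a \sum_b \sum_d
    #|[set S | failing S & all (mem S) [:: a; b; d] && uniq [:: a; b; d]]|)%N.
  pose h (p : {set 'I_6} * ({set 'I_6} * {set 'I_6})) : 3.-tuple {set 'I_6} := [tuple p.1; p.2.1; p.2.2].
  under [RHS]eq_bigr do rewrite pair_big /=.
  rewrite pair_big /= (reindex h) //=.
  exists (fun t => (tnth t (inord 0), (tnth t (inord 1), tnth t (inord 2)))) => [[a [b d]] _|t _].
    by rewrite /h !(tnth_nth finset.set0) !inordK.
  apply/eq_from_tnth => i; rewrite !(tnth_nth finset.set0) !inordK //=.
  by case: i => [[|[|[|?]]] ?].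
under eq_bigr do under eq_bigr do under eq_bigr do rewrite card_failing_above.
(* The factor 64 counts the base points [a]. For fixed [a], translation by [a] is a bijection
   turning the points [b] and [d] into directions. *)
rewrite -[64%N]/(2 ^ 6)%N -[X in (2 ^ X)%N](card_ord 6) -cardsT -card_powerset finset.powersetT cardsT.
rewrite -sum_nat_const; apply: eq_bigr => a _.
rewrite [RHS](reindex_inj (inv_inj (symdiffK a))); apply: eq_bigr => b _.
by rewrite [RHS](reindex_inj (inv_inj (symdiffK a))).
Qed.

End Planes.

(** * Evaluation of the count on bit sequences *)

Fixpoint bitseqs n : seq bitseq :=
  if n is m.+1 then [seq b :: s | b <- [:: true; false], s <- bitseqs m] else [:: [::]].

Lemma mem_bitseqs n s : (s \in bitseqs n) = (size s == n).
Proof.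
elim: n s => [|n IH] [|b s] //=; rewrite ?eqSS -?IH.
  by rewrite cats0 mem_cat; apply/negbTE/norP; split; apply/mapP => -[].
rewrite cats0 mem_cat; apply/orP/idP => [[]/mapP[s' ss' [_ ->]] //|ss].
by case: b; [left|right]; apply: map_f.
Qed.

Definition set_of_bits (s : bitseq) : {set 'I_6} := [set i | nth false s (val i)].

Lemma set_of_bits_inj : {in bitseqs 6 &, injective set_of_bits}.
Proof.
move=> s s'; rewrite !mem_bitseqs => /eqP s6 /eqP s6' /setP e.
apply: (@eq_from_nth _ false) => [|k]; first by rewrite s6.
by rewrite s6 => k6; have := e (Ordinal k6); rewrite !inE.
Qed.

Lemma sum_set_bits (F : {set 'I_6} -> nat) :
  (\sum_u F u = \sum_(s <- bitseqs 6) F (set_of_bits s))%N.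
Proof.
rewrite -(big_map set_of_bits xpredT F); apply: perm_big.
apply: uniq_perm; first exact: index_enum_uniq.
  by rewrite (map_inj_in_uniq set_of_bits_inj).
move=> u; rewrite mem_index_enum; apply/esym/mapP.
exists (mkseq (fun k => inord k \in u) 6); first by rewrite mem_bitseqs size_mkseq.
apply/setP => i; rewrite [RHS]inE nth_mkseq; first by rewrite inord_val.
exact: ltn_ord.
Qed.

Definition failing_bits (s t : bitseq) :=
  [&& has id s, has id t, s != t & has (fun l =>
    let ij := nth (0, 0)%N lex_pairs l in
    let i := ij.1.-1 in let j := ij.2.-1 in
    (nth false s i && nth false t j) (+) (nth false s j && nth false t i)) kept].

Lemma failing_plane_bits s t : s \in bitseqs 6 -> t \in bitseqs 6 ->
  failing_plane (set_of_bits s) (set_of_bits t) = failing_bits s t.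
Proof.
have neq0 r : r \in bitseqs 6 -> (set_of_bits r != finset.set0) = has id r.
  rewrite mem_bitseqs => /eqP r6; apply/set0Pn/hasP => [[i ri]|[b br /= bT]].
    by move: ri; rewrite inE => ri; exists (nth false r i); rewrite ?mem_nth ?r6.
  have b6 : (index b r < 6)%N by rewrite -r6 index_mem.
  by exists (Ordinal b6); rewrite inE /= nth_index.
move=> s6 t6; rewrite /failing_plane /failing_bits !neq0 // (inj_in_eq set_of_bits_inj) //.
congr [&& _, _, _ & _]; apply/existsP/hasP => [[l /andP[lz lw]]|[k kk kw]].
  exists (val l); first by rewrite mem_kept.
  move: lw (lex_pairs_lt l); rewrite /wedge; case: (nth _ _ l) => i j /=.
  by move=> + h; rewrite !inE /= !inordK //; lia.
move: kk; rewrite mem_filter mem_iota => /= /andP[kz k15].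
have {}k15 : (k < 15)%N by move: k15; lia.
exists (Ordinal k15); rewrite -mem_kept mem_filter mem_iota kz k15 /=.
move: kw (lex_pairs_lt (Ordinal k15)); rewrite /wedge /=; case: (nth _ _ k) => i j /=.
by move=> + h; rewrite !inE /= !inordK //; lia.
Qed.

(** Of the [63 * 62 = 3906] ordered pairs spanning a plane, 60 have their wedge supported on the
    zeroed qubits: 6 ordered bases for each of 10 planes. Nine of these are spanned by a nonzero
    vector on coordinates 1, 2 and one on coordinates 4, 5; the tenth is spanned by the basis
    vectors 3 and 6. *)
Lemma count_failing_bits :
  sumn [seq count (failing_bits s) (bitseqs 6) | s <- bitseqs 6] = 3846%N.
Proof. by vm_compute. Qed.

Lemma sum_failing_plane : (\sum_u \sum_v failing_plane u v = 3846)%N.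
Proof.
rewrite -count_failing_bits sumnE big_map sum_set_bits big_seq [RHS]big_seq.
apply: eq_bigr => s s6; rewrite sum_set_bits -sum1_count [RHS]big_mkcond.
rewrite big_seq [RHS]big_seq; apply: eq_bigr => t t6.
by rewrite failing_plane_bits //; case: failing_bits.
Qed.

Section Failures.
Variables (R : realType) (pt : 'I_64 -> 'rV['F_2]_6) (pt_bij : bijective pt).
Let c := quad_code pt.
Let input := zero_plus_state R zeroed_qubits.
Let target := product_state fwires gwires zeroed_qubits (magic_state (TOFs_diag R)) (magic_state (TOFs_diag R)).

Lemma card_failures :
  #|[set e in undetected_failures c input target | hamming e == 4%N]| = 10256%N.
Proof.
rewrite -(card_imset _ (bij_inj (fault_points_bij pt_bij))).
(* Multiplying by 24 avoids a division: [10256 * 24 = 64 * 3846]. *)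
apply/eqP; rewrite -(eqn_pmul2r (isT : 0 < 24)%N).
have -> : fault_points pt @: [set e in undetected_failures c input target | hamming e == 4%N] =
    [set S | failing S].
  have [g gK Kg] := fault_points_bij pt_bij.
  apply/setP => S; rewrite -(Kg S) (mem_imset _ (g S) (can_inj gK)) [LHS]inE [RHS]inE.
  rewrite mem_failures // mem_dual_spaceG0 // -(card_fault_points pt_bij) /failing -andbA.
  congr (_ && _); rewrite andbC; congr (_ && _).
  apply/subsetPn/existsP => [[l lS lz]|[l /andP[lz lS]]]; exists l; rewrite ?lz //=;
    move: lS; by rewrite inE mxE row_logical dot_row // row_support_lshift F2_oddr_neq0.
by rewrite card_failing sum_failing_plane.
Qed.

End Failures.

(** * Error suppression *)

Section ErrorSuppression.
Variables (R : realType) (pt : 'I_64 -> 'rV['F_2]_6) (pt_bij : bijective pt).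
Let c := quad_code pt.
Let input := zero_plus_state R zeroed_qubits.
Let target := product_state fwires gwires zeroed_qubits (magic_state (TOFs_diag R)) (magic_state (TOFs_diag R)).
Let failures := undetected_failures c input target.

(** Acceptance minus success probability, divided by [p ^+ 4]. The truncated exponent is exact
    because failures have weight at least 4. *)
Definition failure_poly : {poly R} :=
  \sum_(e in failures) 'X^(hamming e - 4) * (1 - 'X) ^+ (64 - hamming e).
Definition accept_poly : {poly R} :=
  \sum_(e in dual (spaceG0 c)) 'X^(hamming e) * (1 - 'X) ^+ (64 - hamming e).

Lemma accept_polyE p : accept_poly.[p] = \sum_e fault_prob p e * accept_prob c input e.
Proof.
rewrite horner_sum big_mkcond; apply: eq_bigr => e _.
rewrite quad_accept_prob // !hornerE /fault_prob.
by case: (_ \in dual _); rewrite ?mulr1 ?mulr0.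
Qed.

Lemma failure_polyE p : p ^+ 4 * failure_poly.[p] =
  \sum_e fault_prob p e * accept_prob c input e - \sum_e fault_prob p e * success_prob c input target e.
Proof.
rewrite -sumrB horner_sum mulr_sumr big_mkcond; apply: eq_bigr => e _.
rewrite -mulrBr; case: ifP => [ef|]; rewrite quad_accept_prob // quad_success_prob //.
  rewrite !hornerE -[LHS]/(_ * _ * _) -exprD subnKC; last exact: failures_ge4 ef.
  move: ef; rewrite mem_failures // => /andP[-> /negbTE ->].
  by rewrite subr0 mulr1.
rewrite mem_failures //; case: (_ \in dual _) => /= [/negbFE ->|_];
by rewrite subrr mulr0.
Qed.

Lemma hamming0 : hamming (0 : 'rV['F_2]_64) = 0%N.
Proof. by rewrite -card_supp supp0 finset.cards0. Qed.

Lemma accept_poly0 : accept_poly.[0] = 1.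
Proof.
rewrite horner_sum (bigD1 0) ?dual0 //= big1 => [|e /andP[eG e0]].
  by rewrite hamming0 !hornerE ?subr0 ?expr1n ?mulr1 ?addr0.
by rewrite !hornerE expr0n; case: hamming (dual_spaceG0_ge4 pt_bij eG e0) => //= m _; rewrite mul0r.
Qed.

(** At 0 only the failures of weight exactly 4 keep a nonzero term. *)
Lemma failure_poly0 : failure_poly.[0] = 10256.
Proof.
have -> : 10256 = #|[set e in failures | hamming e == 4%N]|%:R :> R by rewrite (card_failures R pt_bij).
rewrite -sum1_card natr_sum horner_sum.
rewrite [RHS](eq_bigl (fun e => (e \in failures) && (hamming e == 4%N))); last by move=> e; rewrite !inE.
rewrite [RHS]big_mkcondr; apply: eq_bigr => e ef.
rewrite !hornerE expr0n subr0 expr1n mulr1 subn_eq0 eqn_leq.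
by rewrite (failures_ge4 pt_bij ef) andbT; case: (_ <= _)%N.
Qed.

(** The fault-free term is positive and the others are nonnegative. *)
Lemma accept_poly_gt0 p : 0 < p < 1 -> 0 < accept_poly.[p].
Proof.
move=> /andP[p0 p1]; rewrite horner_sum (bigD1 0) ?dual0 //=.
rewrite ltr_wpDr ?sumr_ge0 // => [e _|]; rewrite !hornerE.
  by rewrite mulr_ge0 ?exprn_ge0 ?subr_ge0 ?ltW.
by rewrite mulr_gt0 ?exprn_gt0 ?subr_gt0.
Qed.

(** For small positive [p] the error divided by [p ^+ 4] is a quotient of two polynomials whose
    denominator is 1 at 0, so the limit is the value of the quotient there. *)
Lemma quad_error_suppression : error_suppression c input target 10256 4.
Proof.
rewrite /error_suppression.
have lim : ((fun p => failure_poly.[p] / accept_poly.[p]) @ 0^'+ --> (10256 : R))%classic.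
  rewrite -[10256 : R]divr1 -failure_poly0 -accept_poly0.
  apply: cvg_at_right_filter; apply: cvgM; first exact: continuous_horner.
  by apply: cvgV; [rewrite accept_poly0 oner_eq0|exact: continuous_horner].
apply: cvg_trans lim; apply: near_eq_cvg; near=> p.
have p0 : 0 < p by near: p; exact: nbhs_right_gt.
have p1 : p < 1 by near: p; exact: nbhs_right_lt.
have A0 : accept_poly.[p] != 0 by rewrite gt_eqF // accept_poly_gt0 ?p0.
have p4 : p ^+ 4 != 0 by rewrite expf_neq0 ?gt_eqF.
rewrite /output_error -accept_polyE.
have -> : \sum_e fault_prob p e * success_prob c input target e =
    accept_poly.[p] - p ^+ 4 * failure_poly.[p].
  by rewrite failure_polyE -accept_polyE subKr.
by field; rewrite A0 gt_eqF.
Unshelve. all: by end_near.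
Qed.

End ErrorSuppression.

Theorem mainTheorem15 (R : realType) (pt : 'I_64 -> 'rV['F_2]_6) (pt_bij : bijective pt) :
  let c := quad_code pt in
  let zeroed := lqs [:: 3; 4; 7; 8; 12]%N in
  let A := lqs [:: 1; 10; 11; 14; 15]%N in
  let B := lqs [:: 2; 5; 6; 9; 13]%N in
  [/\ full_rank c, Z_distance c 4 & X_distance c 16] /\
  implements (R := R) c (@transversal_T R 64) (CCZ_circuit full_triples) /\
  [/\ [seq quad_monomial (lq m) | m <- [:: 3; 4; 7; 8; 12]%N]
        = [:: var 1 * var 4; var 1 * var 5; var 2 * var 4; var 2 * var 5; var 3 * var 6],
      [seq quad_monomial (lq m) | m <- [:: 1; 10; 11; 14; 15]%N]
        = [:: var 1 * var 2; var 3 * var 4; var 3 * var 5; var 4 * var 6; var 5 * var 6]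
    & [seq quad_monomial (lq m) | m <- [:: 2; 5; 6; 9; 13]%N]
        = [:: var 1 * var 3; var 1 * var 6; var 2 * var 3; var 2 * var 6; var 4 * var 5]] /\
  (forall (phi : state R 15) (t : {set 'I_15}), zero_on zeroed phi ->
     t \in full_triples -> ~~ [disjoint t & zeroed] -> CCZ t phi = phi) /\
  exists f g : 'I_5 -> 'I_15,
    let input := zero_plus_state R zeroed in
    let target := product_state f g zeroed (magic_state (TOFs_diag R)) (magic_state (TOFs_diag R)) in
    [/\ injective f, injective g, [set f i | i : 'I_5] = A & [set g i | i : 'I_5] = B] /\
    [/\ forall phi : state R 15, zero_on zeroed phi ->
          CCZ_circuit full_triples phi = TOFs_on f (TOFs_on g phi),
        output_state c input 0 = target,
        protocol_distance c input target 4
      & error_suppression c input target 10256 4].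
Proof.
move=> c z A B; split.
  by split; [exact: quad_code_full_rank|exact: quad_code_Z_distance|exact: quad_code_X_distance].
split; first exact: quad_code_implements.
split; first by split; rewrite /= /quad_monomial /lq !inordK.
split; first by move=> phi t phi0 _; exact: CCZ_zero_on.
exists fwires, gwires; split.
  split; [exact: inord_nth_inj|exact: inord_nth_inj| |].
    by rewrite imset_inord_nth // /A lqsE //; exact: index_set_perm.
  by rewrite imset_inord_nth // /B lqsE //; exact: index_set_perm.
split; [exact: CCZ_circuit_zeroed|exact: quad_output_state|exact: quad_protocol_distance|].
exact: quad_error_suppression.
Qed.
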